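(* Let $\Bbbk$ be a field, let $\Delta$ be a pure simplicial complex on $[n]=\{1,\dots,n\}$ with $\Delta\ne 2^{[n]}$, and let $r\ge 2$. Then $$\max\{j : \beta_{i,i+j}(\Bbbk[\Delta^{\vee}])\neq 0\text{ for some }i\le r\}= n-S_{r}\text{-}\mathrm{depth}(\Bbbk[\Delta])-1.$$
   Context: Let $S=\Bbbk[x_1,\dots,x_n]$ with the standard grading, $\mathfrak m=(x_1,\dots,x_n)$, $\omega_S$ the canonical module. For an unmixed finitely generated graded $S$-module $M$ and $r\ge 2$, the Serre depth for $(S_r)$ is $S_r\text{-}\mathrm{depth}(M)=\min\{j : \dim K_M^j\ge j-r+1\}$, where $K_M^j=\mathrm{Hom}_{\Bbbk}(H^j_{\mathfrak m}(M),\Bbbk)\cong \mathrm{Ext}_S^{n-j}(M,\omega_S)$, $\dim$ is Krull dimension, and $\dim 0=-\infty$. A simplicial complex $\Delta$ on $[n]$ is a nonempty collection of subsets of $[n]$ closed under taking subsets (it is not assumed that every $\{i\}$ is in $\Delta$); it is pure if all facets have the same cardinality. $I_\Delta\subset S$ is the ideal generated by the squarefree monomials corresponding to (minimal) non-faces of $\Delta$, and $\Bbbk[\Delta]=S/I_\Delta$. The Alexander dual complex is $\Delta^\vee=\{F\subset[n] : [n]\setminus F\notin\Delta\}$. $\beta_{i,j}(M)$ denotes the $(i,j)$-th graded Betti number of $M$ over $S$. *)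

(* Defs.v *)
From HB Require Import structures.
From mathcomp Require Import all_boot all_order all_algebra.
From mathcomp Require Import generic_quotient ring_quotient.
From mathcomp Require Import boolp.
From mathcomp Require Import mpoly.

Set Implicit Arguments.
Unset Strict Implicit.
Unset Printing Implicit Defensive.

Import Order.TTheory GRing.Theory Num.Theory.
Local Open Scope ring_scope.
Local Open Scope quotient_scope.

Definition is_min (P : int -> Prop) (x : int) :=
  P x /\ forall y, P y -> x <= y.

Definition is_max (P : int -> Prop) (x : int) :=
  P x /\ forall y, P y -> y <= x.

Section Simplicial.
Variable n : nat.
Implicit Types (F G : {set 'I_n}) (Delta : {set {set 'I_n}}).

Definition simplicial_complex Delta :=
  Delta != set0 /\
  forall F G, F \in Delta -> G \subset F -> G \in Delta.

Definition facet Delta F := maxset (fun A => A \in Delta) F.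

Definition pure Delta :=
  forall F G, facet Delta F -> facet Delta G -> #|F| = #|G|.

Definition alexander_dual Delta : {set {set 'I_n}} :=
  [set F | ~: F \notin Delta].

End Simplicial.

Section StanleyReisner.
Variables (n : nat) (k : fieldType).
Local Notation S := {mpoly k[n]}.
Implicit Types (Delta : {set {set 'I_n}}).

Definition sqfree_monomial (F : {set 'I_n}) : S := \prod_(i in F) 'X_i.

(* The ideal generated by the monomials of all non-faces. *)
Definition SR_ideal Delta : pred S := fun p =>
  `[< exists c : {set 'I_n} -> S,
        p = \sum_(F | F \notin Delta) c F * sqfree_monomial F >].

Fact SR_ideal_zmod_closed Delta : zmod_closed (SR_ideal Delta).
Proof.
split=> [|p q /asboolP[c ->] /asboolP[e ->]]; apply/asboolP.
  by exists (fun=> 0); rewrite big1 // => F _; rewrite mul0r.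
exists (fun F => c F - e F); rewrite -sumrB.
by apply: eq_bigr => F _; rewrite mulrBl.
Qed.

HB.instance Definition _ Delta :=
  GRing.isZmodClosed.Build S (SR_ideal Delta) (SR_ideal_zmod_closed Delta).

Lemma SR_idealM Delta (s p : S) :
  p \in SR_ideal Delta -> s * p \in SR_ideal Delta.
Proof.
move=> /asboolP[c ->]; apply/asboolP; exists (fun F => s * c F).
by rewrite mulr_sumr; apply: eq_bigr => F _; rewrite mulrA.
Qed.

(* The S-module k[Delta] = S / I_Delta. *)
Definition SR Delta : Type :=
  {ideal_quot GRing.ZmodClosed.clone S (SR_ideal Delta) _}.

HB.instance Definition _ Delta := GRing.Zmodule.on (SR Delta).
HB.instance Definition _ Delta := Quotient.on (SR Delta).

Definition SR_pi Delta (p : S) : SR Delta := \pi_(SR Delta) p.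

Definition SR_scale Delta (s : S) (x : SR Delta) : SR Delta :=
  SR_pi Delta (s * repr x).

Lemma SR_pi_eq Delta (p q : S) :
  p - q \in SR_ideal Delta -> SR_pi Delta p = SR_pi Delta q.
Proof. by rewrite Quotient.idealrBE => /eqP. Qed.

Lemma SR_piP Delta (x : SR Delta) : exists p, x = SR_pi Delta p.
Proof.
by exists (repr x); rewrite /SR_pi reprK.
Qed.

Lemma SR_piD Delta (p q : S) :
  SR_pi Delta (p + q) = SR_pi Delta p + SR_pi Delta q.
Proof. exact: Quotient.pi_add. Qed.

Lemma SR_scaleE Delta (s p : S) :
  SR_scale s (SR_pi Delta p) = SR_pi Delta (s * p).
Proof.
apply: SR_pi_eq; rewrite -mulrBr; apply: SR_idealM.
by rewrite Quotient.idealrBE reprK.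
Qed.

Fact SR_scaleA Delta (s t : S) (x : SR Delta) :
  SR_scale s (SR_scale t x) = SR_scale (s * t) x.
Proof. by case: (SR_piP x) => p ->; rewrite !SR_scaleE mulrA. Qed.

Fact SR_scale1 Delta : left_id 1 (@SR_scale Delta).
Proof. by move=> x; case: (SR_piP x) => p ->; rewrite SR_scaleE mul1r. Qed.

Fact SR_scaleDr Delta : right_distributive (@SR_scale Delta) +%R.
Proof.
move=> s x y; case: (SR_piP x) => p ->; case: (SR_piP y) => q ->.
by rewrite -SR_piD !SR_scaleE mulrDr SR_piD.
Qed.

Fact SR_scaleDl Delta (x : SR Delta) :
  {morph (@SR_scale Delta)^~ x : s t / s + t}.
Proof.
by move=> s t; case: (SR_piP x) => p ->; rewrite !SR_scaleE mulrDl SR_piD.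
Qed.

HB.instance Definition _ Delta := GRing.Zmodule_isLmodule.Build S (SR Delta)
  (@SR_scaleA Delta) (@SR_scale1 Delta) (@SR_scaleDr Delta)
  (@SR_scaleDl Delta).

(* S is graded by int, with S_d = 0 for d < 0. *)
Definition mpoly_piece (d : int) (p : S) : bool :=
  match d with
  | Posz e => p \is e.-homog
  | Negz _ => p == 0
  end.

Definition SR_piece Delta (d : int) (x : SR Delta) : Prop :=
  exists2 p : S, mpoly_piece d p & x = SR_pi Delta p.

End StanleyReisner.

Section Resolutions.

(* A resolution ... -> F_2 -> F_1 -> F_0 -> M -> 0 by free modules of finite
   rank.  Elements of F_i are row vectors, so that matrices act on the right
   and [diff i] is the differential F_{i+1} -> F_i. *)
Record free_resolution (R : comNzRingType) (M : lmodType R) := FreeResolution {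
  rk : nat -> nat;
  diff : forall i, 'M[R]_(rk i.+1, rk i);
  aug : {linear 'rV[R]_(rk 0) -> M};
  aug_surj : forall x : M, exists v, aug v = x;
  aug_exact : forall v, aug v = 0 <-> exists w, v = w *m diff 0;
  diff_exact : forall i (v : 'rV[R]_(rk i.+1)),
    v *m diff i = 0 <-> exists w, v = w *m diff i.+1
}.

(* [piece d] is the degree d component of M, and F_i is the direct sum of the
   S(- shift i q).  Minimality is d(F_{i+1}) \subset m F_i. *)
Record min_graded_free_resolution (n : nat) (k : fieldType)
    (M : lmodType {mpoly k[n]}) (piece : int -> M -> Prop) :=
  MinGradedFreeResolution {
  resol :> free_resolution M;
  shift : forall i, 'I_(rk resol i) -> int;
  aug_graded : forall q, piece (shift q) (aug resol (delta_mx 0 q));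
  diff_graded : forall i p q,
    mpoly_piece (@shift i.+1 p - @shift i q) (diff resol i p q);
  diff_minimal : forall i p q, (diff resol i p q)@_0%MM = 0
}.

Definition betti (n : nat) (k : fieldType) (M : lmodType {mpoly k[n]})
    (piece : int -> M -> Prop) (F : min_graded_free_resolution piece)
    (i : nat) (j : int) : nat :=
  #|[set q : 'I_(rk F i) | shift q == j]|.

End Resolutions.

Section ExtDim.
Variables (R : comNzRingType) (M : lmodType R) (F : free_resolution M).

(* Hom_R(F_i, R) is identified with column vectors, v acting by u |-> u *m v;
   the coboundary Hom(F_i, R) -> Hom(F_{i+1}, R) is then v |-> diff i *m v. *)
Definition ext_cocycle (i : nat) (v : 'cV[R]_(rk F i)) : Prop :=
  diff F i *m v = 0.

Definition ext_coboundary (i : nat) : 'cV[R]_(rk F i) -> Prop :=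
  match i with
  | 0%N => fun v => v = 0
  | i'.+1 => fun v => exists w : 'cV[R]_(rk F i'), v = diff F i' *m w
  end.

(* The annihilator of Ext^i_R(M, R), which is 0 for i < 0. *)
Definition ext_ann (i : int) (s : R) : Prop :=
  match i with
  | Posz i' => forall v, @ext_cocycle i' v -> ext_coboundary (s *: v)
  | Negz _ => True
  end.

End ExtDim.

(* dim N >= m for an R-module N with annihilator A, the Krull dimension being
   the supremum of the lengths of the chains of primes containing A.  There is
   no such chain when N = 0, in accordance with dim 0 = -oo. *)
Definition dim_ge (R : comNzRingType) (A : R -> Prop) (m : int) : Prop :=
  exists (e : nat) (P : nat -> prime_idealr R),
    [/\ m <= e%:Z,
        forall s, A s -> s \in (P 0%N : {pred R}) &
        forall i, (i < e)%N ->
          {subset (P i : {pred R}) <= (P i.+1 : {pred R})} /\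
          ~ {subset (P i.+1 : {pred R}) <= (P i : {pred R})}].

(* d = min {j | dim K_M^j >= j - r + 1} with K_M^j = Ext_S^{n-j}(M, omega_S).
   Since omega_S = S(-n), and the shift only affects the grading, omega_S is
   replaced by S.  Any free resolution of M may be used to compute Ext. *)
Definition is_serre_depth (n : nat) (k : fieldType) (M : lmodType {mpoly k[n]})
    (F : free_resolution M) (r : nat) (d : int) : Prop :=
  is_min (fun j : int => dim_ge (ext_ann F (n%:Z - j)) (j - r%:Z + 1)) d.

(* Main.v *)
(* A Stanley-Reisner ring k[Delta] has a free resolution with basis the e_(F,T),
   F a face and T disjoint from F, of homological degree #|T| and multidegree
   F :|: T.  Two free resolutions being homotopy equivalent, it computes both
   sides of the theorem.
   Modulo the variables, the resolution of the Alexander dual splits into strands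
   indexed by W = F :|: T; the one for W = ~: G is the complex of the full simplex
   on W modulo the link of G in Delta.  The full simplex being acyclic,
   beta_(i, n - #|G|) of the dual detects the homology of the links of the faces G
   in cardinality i - 1.
   In multidegrees of support G, Ext^(n-j)(k[Delta], S) is the homology of the
   link of G in cardinality j - #|G|.  A nonzero class there is killed only by
   polynomials in the ideal (x_t : t notin G), a prime of coheight #|G|; if there
   are no classes for #|G| >= m, then all squarefree monomials of degree m kill
   Ext, and a prime containing them contains all but m - 1 variables.  Hence
   dim K^j >= j - r + 1 if and only if some G with #|G| >= j - r + 1 has a link
   with homology in cardinality j - #|G|, that is, beta_(i, i + n - j - 1) of the
   dual is nonzero for i = j - #|G| + 1 <= r. *)

From HB Require Import structures.
Require Import Defs.
From mathcomp Require Import all_boot all_order all_algebra.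
From mathcomp Require Import ring_quotient.
From mathcomp Require Import boolp.
From mathcomp Require Import mpoly zify.

Set Implicit Arguments.
Unset Strict Implicit.
Unset Printing Implicit Defensive.

Import Order.TTheory GRing.Theory Num.Theory.
Local Open Scope ring_scope.

(** * Comparison of free resolutions *)

(** One formula for the differential serves three values of its parameters [x]: the variables for
    the resolution, 0 for Betti numbers, 1 for the strands of Ext. The resolution is exact because
    every monomial has a normal form, the squarefree monomial of its support F times a monomial in
    the variables of F; division by one variable at a time leads to it. The given resolutions are
    arbitrary, so each is compared with the explicit one: up to homotopy for Ext, and with degrees
    kept for Betti numbers. Krull dimension means chains of primes. Lower bounds come from primes
    generated by variables. The upper bound is a count: c + 1 strict steps above a prime that
    contains all but c variables would give more products, linearly independent modulo that prime,
    than there are monomials available in c variables. The generator of k[Delta^vee] in degree 0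
    corresponds to no link. It contributes only the value j = 0, which is at most n - d - 1 because
    the link of a largest face, a proper subset of [n], forces d < n. *)

Section Comparison.
Variables (R : comNzRingType) (M : lmodType R).
Implicit Types A B : free_resolution M.

Definition res_cycle A i : 'rV[R]_(rk A i) -> Prop :=
  match i with
  | 0%N => fun v => aug A v = 0
  | i'.+1 => fun v => v *m diff A i' = 0
  end.

Lemma res_cycleP A i (v : 'rV[R]_(rk A i)) :
  res_cycle v <-> exists w, v = w *m diff A i.
Proof. by case: i v => [|i] v; [exact: aug_exact | exact: diff_exact]. Qed.

Lemma res_cycle_diff A i : forall w, res_cycle (w *m diff A i).
Proof. by move=> w; apply/res_cycleP; exists w. Qed.

Lemma rows_factor (m p q : nat) (X : 'M[R]_(m, q)) (Y : 'M[R]_(p, q)) :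
  (forall r, exists w, row r X = w *m Y) -> {Z : 'M[R]_(m, p) | X = Z *m Y}.
Proof.
move=> h; pose w r := sval (cid (h r)).
exists (\matrix_r w r); apply/row_matrixP => r.
by rewrite row_mul rowK; exact: svalP (cid (h r)).
Qed.

(** Stated on cycles so that one induction step covers degree 0 too, where a cycle is an element
    killed by [aug]. *)
Definition cycle_map A B i (phi : 'M[R]_(rk A i, rk B i)) :=
  forall v, res_cycle v -> res_cycle (v *m phi).

Lemma lift0_subproof A B :
  {phi : 'M[R]_(rk A 0, rk B 0) | forall v, aug B (v *m phi) = aug A v}.
Proof.
have h (r : 'I_(rk A 0)) : exists w, aug B w = aug A (delta_mx 0 r).
  exact: aug_surj.
pose w r := sval (cid (h r)).
exists (\matrix_r w r) => v.
rewrite mulmx_sum_row linear_sum [in RHS](row_sum_delta v) linear_sum.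
apply: eq_bigr => r _; rewrite rowK !linearZ /=.
by rewrite (svalP (cid (h r))).
Qed.

(** Each row of [diff A i *m phi] is the image of a cycle, hence a cycle of B, and exactness of B
    factors it. The result is a sigma type because the recursion that builds the chain map needs the
    matrix itself. *)
Lemma lift_step A B i (phi : 'M[R]_(rk A i, rk B i)) : cycle_map phi ->
  {psi : 'M[R]_(rk A i.+1, rk B i.+1) |
     diff A i *m phi = psi *m diff B i & cycle_map psi}.
Proof.
move=> hphi.
have [psi e] : {psi | diff A i *m phi = psi *m diff B i}.
  apply: rows_factor => r; rewrite row_mul; apply/res_cycleP/hphi.
  by rewrite rowE; exact: res_cycle_diff.
by exists psi => // v /= hv; rewrite -mulmxA -e mulmxA hv mul0mx.
Qed.

Record chain_map A B := ChainMap {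
  cmap : forall i, 'M[R]_(rk A i, rk B i);
  cmap_aug : forall v, aug B (v *m cmap 0) = aug A v;
  cmap_diff : forall i, diff A i *m cmap i = cmap i.+1 *m diff B i
}.

Lemma chain_map_exists A B : inhabited (chain_map A B).
Proof.
have [phi0 e0] := lift0_subproof A B.
have c0 : cycle_map phi0 by move=> v /= hv; rewrite e0.
pose f := fix f i : {phi : 'M[R]_(rk A i, rk B i) | cycle_map phi} :=
  match i with
  | 0%N => exist _ phi0 c0
  | i'.+1 => let s := lift_step (svalP (f i')) in exist _ (s2val s) (s2valP' s)
  end.
exists; apply: (@ChainMap _ _ (fun i => sval (f i))) => //= i.
exact: (s2valP (lift_step (svalP (f i)))).
Qed.

Record null_homotopy A B (chi : forall i, 'M[R]_(rk A i, rk B i)) :=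
  NullHomotopy {
  hmap : forall i, 'M[R]_(rk A i, rk B i.+1);
  hmap0 : chi 0%N = hmap 0 *m diff B 0;
  hmapS : forall i, chi i.+1 = diff A i *m hmap i + hmap i.+1 *m diff B i.+1
}.

Lemma null_homotopy_exists A B (chi : forall i, 'M[R]_(rk A i, rk B i)) :
  (forall v, aug B (v *m chi 0%N) = 0) ->
  (forall i, diff A i *m chi i = chi i.+1 *m diff B i) ->
  inhabited (null_homotopy chi).
Proof.
move=> h0 hS.
have [k0 e0] : {k | chi 0%N = k *m diff B 0}.
  by apply: rows_factor => r; apply/aug_exact; rewrite rowE h0.
(* [good i k] says that the rows of [chi i.+1 - diff A i *m k] are cycles of B, which is what the
   choice of the next homotopy requires. *)
pose good i (k : 'M[R]_(rk A i, rk B i.+1)) :=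
  diff A i *m (chi i - k *m diff B i) = 0.
have good0 : good 0%N k0 by rewrite /good -e0 subrr mulmx0.
have step i (k : 'M[R]_(rk A i, rk B i.+1)) : good i k ->
    {l : 'M[R]_(rk A i.+1, rk B i.+2) |
       chi i.+1 = diff A i *m k + l *m diff B i.+1 & good i.+1 l}.
  move=> gk.
  have [l e] : {l | chi i.+1 - diff A i *m k = l *m diff B i.+1}.
    apply: rows_factor => r; apply/diff_exact.
    rewrite rowE -mulmxA mulmxBl -mulmxA -hS -mulmxBr.
    by move: gk; rewrite /good => ->; rewrite mulmx0.
  exists l; first by rewrite -e addrC subrK.
  rewrite /good -e opprB addrC subrK mulmxA.
  suff -> : diff A i.+1 *m diff A i = 0 by rewrite mul0mx.
  apply/row_matrixP => r; rewrite row_mul row0 rowE.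
  exact: (res_cycle_diff (delta_mx 0 r)).
pose f := fix f i : {k : 'M[R]_(rk A i, rk B i.+1) | good i k} :=
  match i with
  | 0%N => exist _ k0 good0
  | i'.+1 => let s := step i' _ (svalP (f i')) in exist _ (s2val s) (s2valP' s)
  end.
exists; apply: (@NullHomotopy _ _ _ (fun i => sval (f i))) => //= i.
exact: (s2valP (step i _ (svalP (f i)))).
Qed.

Lemma homotopy_inverse A B (phi : chain_map A B) (psi : chain_map B A) :
  inhabited (null_homotopy (fun i => 1%:M - cmap phi i *m cmap psi i)).
Proof.
apply: null_homotopy_exists => [v|i].
  by rewrite mulmxBr mulmx1 linearB /= mulmxA !cmap_aug subrr.
rewrite mulmxBr mulmxBl mulmx1 mul1mx; congr (_ - _).
by rewrite mulmxA cmap_diff -!mulmxA cmap_diff.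
Qed.

(** The comparison maps are inverse up to homotopy, so a cocycle of B differs by a coboundary from
    one pulled back from A, and s turns the latter into a coboundary. *)
Lemma ext_ann_transfer A B i s : ext_ann A i s -> ext_ann B i s.
Proof.
case: i => // i hA v hv.
have [phi] := chain_map_exists A B; have [psi] := chain_map_exists B A.
have [h] := homotopy_inverse psi phi.
have cphi : ext_cocycle (cmap phi i *m v).
  rewrite /ext_cocycle mulmxA cmap_diff -mulmxA.
  by move: hv; rewrite /ext_cocycle => ->; rewrite mulmx0.
have -> : v = (1%:M - cmap psi i *m cmap phi i) *m v
              + cmap psi i *m (cmap phi i *m v).
  by rewrite mulmxBl mul1mx -mulmxA subrK.
have {hA cphi} := hA _ cphi; move: hv; rewrite /ext_cocycle.
case: i v => [|i] v /= hv.
  rewrite (hmap0 h) -mulmxA hv mulmx0 add0r => e.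
  by rewrite scalemxAr e mulmx0.
case=> w e; rewrite (hmapS h) mulmxDl -[X in _ + X + _]mulmxA hv mulmx0 addr0.
exists (s *: (hmap h i *m v) + cmap psi i *m w).
rewrite mulmxDr -scalemxAr scalerDr -[diff B i *m _ *m v]mulmxA.
by congr (_ + _); rewrite scalemxAr e !mulmxA cmap_diff.
Qed.

End Comparison.

(** * The squarefree resolution of a Stanley-Reisner ring *)

Section KoszulSigns.
Variables (n : nat) (R : comNzRingType).
Implicit Types (s t u : 'I_n) (T F : {set 'I_n}).

Definition sgn t T : R := (-1) ^+ #|[set s in T | (s < t)%N]|.

Lemma sgnK t T : sgn t T * sgn t T = 1.
Proof. by rewrite -expr2 sqrr_sign. Qed.

Lemma sgnU1 s t T : s \notin T -> sgn t (s |: T) = (-1) ^+ (s < t)%N * sgn t T.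
Proof.
move=> sT; rewrite /sgn -exprD; congr (_ ^+ _).
case: ltnP => st; last first.
  apply: eq_card => v; rewrite !inE; case: eqVneq => //= ->.
  by rewrite ltnNge st andbF.
rewrite (_ : [set _ in s |: T | _] = s |: [set v in T | (v < t)%N]).
  by rewrite cardsU1 !inE (negPf sT).
by apply/setP => v; rewrite !inE; case: eqVneq => //= ->.
Qed.

Lemma sgnUself t T : sgn t (t |: T) = sgn t T.
Proof.
congr (_ ^+ _); apply: eq_card => v; rewrite !inE.
by case: eqVneq => //= ->; rewrite ltnn andbF.
Qed.

Lemma sgnDself t T : sgn t (T :\ t) = sgn t T.
Proof.
congr (_ ^+ _); apply: eq_card => v; rewrite !inE.
by case: eqVneq => //= ->; rewrite ltnn andbF.
Qed.

Lemma sgn_swap s t T : s != t -> s \notin T -> t \notin T ->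
  sgn s (t |: T) * sgn t (s |: T) = - (sgn s T * sgn t T).
Proof.
move=> st sT tT; rewrite !sgnU1 // mulrACA -signr_addb -[RHS]mulN1r; congr (_ * _).
by move: st; rewrite -val_eqE /=; case: ltngtP.
Qed.

Lemma sgn_anti s t T : s != t -> s \notin T -> t \notin T ->
  sgn s T * sgn t (s |: T) = - (sgn t T * sgn s (t |: T)).
Proof.
move=> st sT tT.
transitivity (sgn s T * sgn s (t |: T) * (sgn s (t |: T) * sgn t (s |: T))).
  by rewrite mulrA -[sgn s T * _ * _]mulrA sgnK mulr1.
by rewrite sgn_swap // mulrN mulrACA sgnK mul1r mulrC.
Qed.

(** The terms cancel in pairs, s < t against t < s, so that characteristic 2 is covered as well. *)
Lemma alternating_sum0 (V : zmodType) (a : 'I_n -> 'I_n -> V) :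
  (forall s t, s != t -> a s t = - a t s) ->
  \sum_s \sum_(t | t != s) a s t = 0.
Proof.
move=> ha.
have e s : \sum_(t | t != s) a s t =
    \sum_(t : 'I_n | (t < s)%N) a s t + \sum_(t : 'I_n | (s < t)%N) a s t.
  rewrite (bigID (fun t : 'I_n => (t < s)%N)) /=; congr (_ + _);
    by apply: eq_bigl => t; rewrite -val_eqE /=; case: ltngtP.
under eq_bigr do rewrite e.
rewrite big_split /= [X in _ + X](exchange_big_dep predT) //= -big_split /=.
rewrite big1 // => s _; rewrite -big_split big1 //= => t ts.
by rewrite ha ?addNr // -val_eqE /= gtn_eqF.
Qed.

End KoszulSigns.

Section Boundary.
Variables (n : nat) (R : comNzRingType) (x : 'I_n -> R).
Variable Delta : {set {set 'I_n}}.
Hypothesis Delta_closed : forall F G : {set 'I_n},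
  F \in Delta -> G \subset F -> G \in Delta.
Implicit Types (s t u : 'I_n) (T F : {set 'I_n}).
Implicit Types f : {set 'I_n} -> {set 'I_n} -> R.

(* f F T is the coefficient of a basis element e_(F,T) with F a face disjoint
   from T; its differential is the sum over t in T of
   sgn t T * (x_t e_(F, T - t) - e_(F + t, T - t)), where e_(F + t, T - t) = 0
   unless F + t is a face. *)
Definition bd f F T : R :=
  if F \in Delta then
    \sum_(t | t \notin T)
      sgn R t T * (x t * f F (t |: T) - f (F :\ t) (t |: T) *+ (t \in F))
  else 0.

Definition chain i f := forall F T, f F T != 0 ->
  [/\ F \in Delta, [disjoint F & T] & #|T| = i].

Lemma sub_Delta F t : F \in Delta -> F :\ t \in Delta.
Proof. by move=> h; apply: Delta_closed h _; rewrite subsetDl. Qed.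

Lemma bd_chain i f : chain i.+1 f -> chain i (bd f).
Proof.
move=> hf F T; rewrite /bd; case: ifP => [FD|]; last by rewrite eqxx.
move=> nz.
have : [exists t, (t \notin T) && (x t * f F (t |: T)
            - f (F :\ t) (t |: T) *+ (t \in F) != 0)].
  apply: contraNT nz; rewrite negb_exists => /forallP h.
  apply/eqP/big1 => t tT; move: (h t); rewrite tT negbK => /eqP ->.
  by rewrite mulr0.
case/existsP => t /andP[tT].
have [fn|fn] := eqVneq (f F (t |: T)) 0; last first.
  move=> _; have [_ dj] := hf _ _ fn; rewrite cardsU1 tT => -[<-]; split=> //.
  by apply: disjointWr dj; rewrite subsetUr.
rewrite fn mulr0 sub0r oppr_eq0; case tF : (t \in F); last by rewrite eqxx.
rewrite mulr1n => fn'; have [_ dj] := hf _ _ fn'.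
rewrite cardsU1 tT => -[<-]; split=> //.
rewrite -(setD1K tF) disjoints_subset subUset sub1set inE tT -disjoints_subset.
by apply: disjointWr dj; rewrite subsetUr.
Qed.

Lemma bd_chain0 f : chain 0 f -> forall F T, bd f F T = 0.
Proof.
move=> hf F T; rewrite /bd; case: ifP => // _; apply: big1 => t tT.
have z (G : {set 'I_n}) : f G (t |: T) = 0.
  apply/eqP; apply: contraT => /hf[_ _ /eqP].
  by rewrite cards_eq0 => /eqP/setP/(_ t); rewrite !inE eqxx.
by rewrite !z mulr0 mul0rn subr0 mulr0.
Qed.

Lemma bd_eq f g : f =2 g -> bd f =2 bd g.
Proof.
move=> e F T; rewrite /bd; case: ifP => // _; apply: eq_bigr => t _.
by rewrite !e.
Qed.

Lemma bd0 F T : bd (fun _ _ => 0) F T = 0.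
Proof.
rewrite /bd; case: ifP => // _; apply: big1 => t _.
by rewrite mulr0 mul0rn subr0 mulr0.
Qed.

Lemma bdB f g F T :
  bd (fun F T => f F T - g F T) F T = bd f F T - bd g F T.
Proof.
rewrite /bd; case: ifP => // _; last by rewrite subr0.
rewrite -sumrB; apply: eq_bigr => t _.
rewrite -[RHS]mulrBr [x t * _]mulrBr mulrnBl; congr (_ * _).
by rewrite !opprD !opprK addrACA.
Qed.

(** For fixed s and t the bracket [X s t] is symmetric and the product of signs is antisymmetric.
    Closure of Delta ensures that the face test does not cut off the inner differential at
    [F :\ s]. *)
Lemma bd_bd f F T : bd (bd f) F T = 0.
Proof.
rewrite {1}/bd; case: ifP => // FD.
pose X s t := x s * (x t * f F (t |: (s |: T))
                  - f (F :\ t) (t |: (s |: T)) *+ (t \in F))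
  - (x t * f (F :\ s) (t |: (s |: T))
      - f (F :\ s :\ t) (t |: (s |: T)) *+ (t \in F :\ s)) *+ (s \in F).
pose a s t := if (s \notin T) && (t \notin T)
              then sgn R s T * sgn R t (s |: T) * X s t else 0.
rewrite -[RHS](@alternating_sum0 n _ a).
  rewrite big_mkcond; apply: eq_bigr => s _; rewrite /a.
  case: ifP => sT /=; last by rewrite big1.
  rewrite /bd FD sub_Delta // -sumrMnl mulr_sumr -sumrB mulr_sumr.
  rewrite [RHS]big_mkcond [LHS]big_mkcond; apply: eq_bigr => t _.
  rewrite in_setU1 negb_or; case: eqVneq => //= _.
  case: ifP => //= tT; rewrite -mulrA; congr (_ * _).
  by rewrite /X [RHS]mulrBr; congr (_ - _); rewrite ?mulrnAr // mulrCA.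
move=> s t st; rewrite /a [(t \notin T) && _]andbC; case: ifP => [/andP[sT tT]|].
  rewrite sgn_anti // mulNr; congr (- (_ * _)); rewrite /X.
  rewrite setUCA !inE st eq_sym st /= 2!setDDl [[set t; s]]setUC.
  case: (s \in F); case: (t \in F); rewrite ?mulr1n ?mulr0n ?subr0 //.
  - rewrite !mulrBr !opprB mulrCA -!addrA; congr (_ + _).
    by rewrite addrCA [RHS]addrCA; congr (_ + _); rewrite addrC.
  - by rewrite !mulrBr mulrCA.
  - by rewrite !mulrBr mulrCA.
  - by rewrite mulrCA.
by rewrite oppr0.
Qed.

End Boundary.

(** * Exactness by division by one variable at a time *)

Section Contraction.
Variables (n : nat) (R : comNzRingType) (x : 'I_n -> R).
Variable Delta : {set {set 'I_n}}.
Hypothesis Delta_closed : forall F G : {set 'I_n},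
  F \in Delta -> G \subset F -> G \in Delta.
Variable q : 'I_n -> {additive R -> R}.
Hypothesis qxK : forall u p, q u (x u * p) = p.
Hypothesis qxC : forall u t p, u != t -> q u (x t * p) = x t * q u p.
Hypothesis qqC : forall u t p, q u (q t p) = q t (q u p).
Implicit Types (s t u : 'I_n) (T F : {set 'I_n}).
Implicit Types f g : {set 'I_n} -> {set 'I_n} -> R.
Local Notation bd := (bd x Delta).
Local Notation chain := (@chain n R Delta).

(** The contracting homotopy of a Koszul complex in the direction u, where [q u] stands for division
    by x_u with the remainder dropped. *)
Definition contract u f F T : R :=
  if (u \in T) && (u \notin F) then sgn R u T * q u (f F (T :\ u)) else 0.

Lemma q_sgn u t T p : q u (sgn R t T * p) = sgn R t T * q u p.
Proof. exact: raddfMsign. Qed.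

(* Hence 1 - (bd h_u + h_u bd), with h_u = contract u, kills the e_(F,T) with u
   in T and leaves no x_u in the coefficients of those with u outside F. *)
Lemma bd_contract u f F T : F \in Delta -> [disjoint F & T] ->
  bd (contract u f) F T + contract u (bd f) F T =
  if u \in T then f F T else
  if u \in F then - q u (f (F :\ u) T) else x u * q u (f F T).
Proof.
move=> FD dj; case: ifP => uT; last first.
  rewrite [X in _ + X]/contract uT addr0 /bd FD (bigD1 u) ?uT //= big1.
    rewrite addr0 /contract setU11 in_setD1 eqxx setU1K ?uT //= sgnUself.
    case: (u \in F); rewrite /= ?mulr1n ?mulr0n ?mulr0 ?sub0r ?subr0.
      by rewrite mulrN mulrA sgnK mul1r.
    by rewrite mulrCA [sgn _ _ _ * (_ * _)]mulrA sgnK mul1r.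
  move=> t /andP[tT tu]; rewrite /contract in_setU1 uT orbF eq_sym (negPf tu) /=.
  by rewrite mulr0 mul0rn subr0 mulr0.
have uF : u \notin F by rewrite (disjointFl dj).
have uT' : u \notin T :\ u by rewrite !inE eqxx.
rewrite -(setD1K uT) in dj *; move: (T :\ u) uT' dj => T' uT' dj.
rewrite {2}/contract setU11 uF /= setU1K // /bd FD raddf_sum mulr_sumr.
rewrite (bigD1 (P := fun t => t \notin T') u) //= q_sgn mulrA.
rewrite sgnUself sgnK mul1r (negPf uF) mulr0n subr0 qxK addrCA.
rewrite -[RHS]addr0; congr (_ + _).
rewrite [X in _ + X](eq_bigl (fun t => (t \notin u |: T'))); last first.
  by move=> t; rewrite in_setU1 negb_or andbC.
rewrite -big_split big1 //= => t; rewrite in_setU1 negb_or => /andP[tu tT'].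
rewrite /contract !inE eqxx orbT /= uF (negPf uF) andbF /=.
have -> : (t |: (u |: T')) :\ u = t |: T'.
  by rewrite setUCA setU1K // in_setU1 negb_or eq_sym tu.
rewrite setUCA !sgnUself q_sgn raddfB qxC ?(eq_sym u) //.
rewrite [x t * (_ * _)]mulrCA -mulrnAr -mulrBr !mulrA.
rewrite [q u (_ *+ _)]raddfMn -mulrDl.
by rewrite sgn_swap // [sgn R u T' * _]mulrC addNr mul0r.
Qed.

Lemma contract_chain u i f : chain i f -> chain i.+1 (contract u f).
Proof.
move=> hf F T; rewrite /contract; case: ifP => [/andP[uT uF]|]; last first.
  by rewrite eqxx.
have [-> | nz _] := eqVneq (f F (T :\ u)) 0; first by rewrite raddf0 mulr0 eqxx.
have [FD dj <-] := hf _ _ nz; split=> //; last by rewrite (cardsD1 u T) uT.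
by rewrite -(setD1K uT) disjoint_sym disjoints_subset subUset sub1set inE uF
  -disjoints_subset disjoint_sym.
Qed.

Lemma contract0 u f F T : (forall F T, f F T = 0) -> contract u f F T = 0.
Proof. by move=> h; rewrite /contract; case: ifP; rewrite // h raddf0 mulr0. Qed.

Lemma chainB i f g : chain i f -> chain i g -> chain i (fun F T => f F T - g F T).
Proof.
move=> hf hg F T; have [e|/hf //] := eqVneq (f F T) 0.
by rewrite e sub0r oppr_eq0 => /hg.
Qed.

(** The boundary of [contract u] is subtracted for one vertex u after the other; the commutation
    rules for the [q u] keep the earlier reductions intact. What remains of a cycle lives on the
    e_(F, set0), with coefficients free of the variables outside F. *)
Lemma bd_reduce i f : chain i f -> (forall F T, bd f F T = 0) ->
  exists g, [/\ chain i.+1 g,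
    forall F T, T != set0 -> f F T - bd g F T = 0 &
    forall u F T, u \notin F -> q u (f F T - bd g F T) = 0].
Proof.
move=> hf cf.
suff key : forall r : seq 'I_n, exists g, chain i.+1 g /\
    forall u, u \in r -> forall F T,
      (u \in T -> f F T - bd g F T = 0) /\
      (u \notin F -> q u (f F T - bd g F T) = 0).
  have [g [hg h]] := key (enum 'I_n).
  have {}h u := h u (mem_enum predT u).
  exists g; split=> // [F T /set0Pn[u uT]|u F T].
    exact: (h u F T).1.
  exact: (h u F T).2.
elim=> [|u r [g [hg IH]]].
  exists (fun _ _ => 0); split=> // F T; rewrite eqxx //.
pose f' F T := f F T - bd g F T.
have hf' : chain i f' by apply: chainB => //; apply: bd_chain.
have cf' F T : bd f' F T = 0 by rewrite bdB cf bd_bd // subr0.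
(* A sum, written as a difference so that [chainB] and [bdB] apply. *)
exists (fun F T => g F T - - contract u f' F T).
have hcN : chain i.+1 (fun F T => - contract u f' F T).
  by move=> F T; rewrite oppr_eq0; apply: contract_chain.
split; first exact: chainB.
have e F T : f F T - bd (fun F T => g F T - - contract u f' F T) F T =
    if (F \in Delta) && [disjoint F & T] then
      if u \in T then 0 else
      if u \in F then f' F T + q u (f' (F :\ u) T)
      else f' F T - x u * q u (f' F T)
    else 0.
  have -> : f F T - bd (fun F T => g F T - - contract u f' F T) F T =
      f' F T - bd (contract u f') F T.
    rewrite (bd_eq _ _ (g := fun F T => g F T - (0 - contract u f' F T))).
      rewrite bdB bdB opprB addrA [X in _ = X]addrAC /f'.
      rewrite bd0 sub0r.
      by rewrite addrAC.
    by move=> ? ? /=; rewrite sub0r.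
  case: ifP => [/andP[FD dj]|h].
    have := bd_contract u f' FD dj; rewrite contract0 // addr0 => ->.
    case: ifP => // _; first by rewrite subrr.
    by case: ifP => // _; rewrite opprK.
  have [e1|/hf'[h1 h2]] := eqVneq (f' F T) 0; last by rewrite h1 h2 in h.
  rewrite e1 sub0r; apply/eqP; rewrite oppr_eq0; apply: contraFT h.
  by case/(bd_chain (contract_chain hf')) => -> ->.
move=> v; rewrite inE => /orP[/eqP-> {v} F T | vr F T]; rewrite e.
  case: ifP => _; last by rewrite raddf0.
  case: ifP => uT; first by rewrite raddf0.
  split=> // /negPf->; by rewrite raddfB qxK subrr.
have [h1 h2] := IH v vr F T; have [h3 h4] := IH v vr (F :\ u) T.
case: ifP => _; last by rewrite raddf0.
case: ifP => uT; first by rewrite raddf0.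
split=> [vT|vF].
  rewrite /f' h1 // h3 // raddf0 mulr0 addr0 subr0.
  by case: ifP.
case: ifP => uF.
  by rewrite raddfD /f' h2 // qqC h4 ?raddf0 ?addr0 // !inE (negPf vF) andbF.
have [->|vu] := eqVneq v u; first by rewrite raddfB qxK subrr.
by rewrite raddfB qxC // qqC /f' h2 // raddf0 mulr0 subr0.
Qed.

End Contraction.

(** * Chains as functions on pairs of sets, and the corresponding vectors and matrices *)

Section Matrices.
Variables (n : nat) (R : comNzRingType) (x : 'I_n -> R).
Variable Delta : {set {set 'I_n}}.
Implicit Types (s t u : 'I_n) (T F : {set 'I_n}) (c : {set 'I_n} * {set 'I_n}).
Implicit Types f g : {set 'I_n} -> {set 'I_n} -> R.

Definition cells i : {set {set 'I_n} * {set 'I_n}} :=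
  [set c : {set 'I_n} * {set 'I_n} |
    [&& c.1 \in Delta, [disjoint c.1 & c.2] & #|c.2| == i]].

(** The transpose of [bd]. Disjointness is tested because [(F, T :\ t)] can be a cell while t lies
    in both F and T; membership of F in Delta is inherited from the support of f. *)
Definition cobd f F T : R :=
  if [disjoint F & T] then
    \sum_(t in T) sgn R t T * (x t * f F (T :\ t) - f (t |: F) (T :\ t))
  else 0.

Definition bd_coef c c' : R :=
  \sum_(t in c.2) sgn R t c.2 *
    (x t *+ (c' == (c.1, c.2 :\ t)) - (c' == (t |: c.1, c.2 :\ t))%:R).

Definition bdmx i : 'M[R]_(#|cells i.+1|, #|cells i|) :=
  \matrix_(p, q) bd_coef (enum_val p) (enum_val q).

Definition vec i f : 'rV[R]_#|cells i| :=
  \row_p f (enum_val p).1 (enum_val p).2.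

Definition cvec i f : 'cV[R]_#|cells i| :=
  \col_p f (enum_val p).1 (enum_val p).2.

Lemma chain_cells i f F T : chain Delta i f -> (F, T) \notin cells i -> f F T = 0.
Proof.
by move=> hf; apply: contraNeq => /hf[h1 h2 h3]; rewrite inE /= h1 h2 h3 eqxx.
Qed.

Lemma cellsP i c :
  reflect [/\ c.1 \in Delta, [disjoint c.1 & c.2] & #|c.2| = i] (c \in cells i).
Proof.
rewrite inE; apply: (iffP and3P) => -[h1 h2 h3]; split=> //; exact/eqP.
Qed.

Definition unvec i (a : 'I_#|cells i| -> R) F T : R :=
  \sum_p a p *+ (enum_val p == (F, T)).

Lemma unvec_chain i a : chain Delta i (@unvec i a).
Proof.
move=> F T nz.
suff /existsP[p /eqP e] : [exists p : 'I_#|cells i|, enum_val p == (F, T)].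
  by have := enum_valP p; rewrite e => /cellsP[].
apply: contraNT nz; rewrite negb_exists => /forallP h; apply/eqP/big1 => p _.
by rewrite (negPf (h p)).
Qed.

Lemma unvecE i a p : @unvec i a (enum_val p).1 (enum_val p).2 = a p.
Proof.
rewrite /unvec -surjective_pairing (bigD1 p) //= eqxx big1 ?addr0 // => q qp.
by rewrite (inj_eq enum_val_inj) (negPf qp).
Qed.

Lemma vec_surj i (v : 'rV[R]_#|cells i|) :
  exists2 f, chain Delta i f & v = vec i f.
Proof.
exists (unvec (v 0)); first exact: unvec_chain.
by apply/rowP => p; rewrite mxE unvecE.
Qed.

Lemma cvec_surj i (v : 'cV[R]_#|cells i|) :
  exists2 f, chain Delta i f & v = cvec i f.
Proof.
exists (unvec (v^~ 0)); first exact: unvec_chain.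
by apply/colP => p; rewrite mxE unvecE.
Qed.

Lemma vecP i f g : chain Delta i f -> chain Delta i g ->
  vec i f = vec i g <-> f =2 g.
Proof.
move=> hf hg; split=> [e F T|e]; last by apply/rowP => p; rewrite !mxE e.
have [h|h] := boolP ((F, T) \in cells i).
  have /rowP/(_ (enum_rank_in h (F, T))) := e.
  by rewrite !mxE enum_rankK_in.
by rewrite (chain_cells hf h) (chain_cells hg h).
Qed.

Lemma cvecP i f g : chain Delta i f -> chain Delta i g ->
  cvec i f = cvec i g <-> f =2 g.
Proof.
move=> hf hg; split=> [e F T|e]; last by apply/colP => p; rewrite !mxE e.
have [h|h] := boolP ((F, T) \in cells i).
  have /colP/(_ (enum_rank_in h (F, T))) := e.
  by rewrite !mxE enum_rankK_in.
by rewrite (chain_cells hf h) (chain_cells hg h).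
Qed.

Lemma chain_sum i f (a : {set 'I_n} * {set 'I_n} -> R) : chain Delta i f ->
  \sum_(p < #|cells i|) f (enum_val p).1 (enum_val p).2 * a (enum_val p) =
  \sum_c f c.1 c.2 * a c.
Proof.
move=> hf; rewrite -(big_enum_val (fun c => f c.1 c.2 * a c)) /= big_mkcond /=.
apply: eq_bigr => -[F T] _ /=; case: ifPn => // h.
by rewrite (chain_cells hf h) mul0r.
Qed.

Lemma vec_bd i f : chain Delta i.+1 f ->
  vec i.+1 f *m bdmx i = vec i (bd x Delta f).
Proof.
move=> hf; apply/rowP => q; rewrite !mxE.
under eq_bigr do rewrite !mxE.
rewrite (chain_sum (fun c => bd_coef c (enum_val q))) //.
case: (enum_val q) (enum_valP q) => F T /cellsP[/= FD dj _] {q}.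
rewrite /bd FD [RHS]big_mkcond /=.
under eq_bigr do rewrite /bd_coef mulr_sumr big_mkcond.
rewrite exchange_big /=; apply: eq_bigr => t _; case: ifPn => [tT|]; last first.
  rewrite negbK => tT; apply: big1 => -[F' T'] _ /=; case: ifP => // _.
  rewrite !xpair_eqE (_ : (T == T' :\ t) = false) ?andbF ?mulr0n ?subr0 ?mulr0 //.
  by apply/negP => /eqP e; move: tT; rewrite e !inE eqxx.
have tT' T' : t \in T' -> (T == T' :\ t) = (T' == t |: T).
  move=> h; apply/eqP/eqP => [->|->]; first by rewrite setD1K.
  by rewrite setU1K.
rewrite mulrBr mulrnAr.
(* For fixed t, only the cells [(F, t |: T)] and, when t is in F, [(F :\ t, t |: T)] contribute to
   the coefficient at [(F, T)]. *)
rewrite (eq_bigr (fun c =>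
   (if c == (F, t |: T) then sgn R t T * (f F (t |: T) * x t) else 0)
   - (if (c == (F :\ t, t |: T)) && (t \in F)
      then sgn R t T * f (F :\ t) (t |: T) else 0))).
  rewrite sumrB -big_mkcond big_pred1_eq; congr (_ - _).
    by rewrite [x t * _]mulrC.
  case: (t \in F); last by rewrite big1 // => c _; rewrite andbF.
  under eq_bigr do rewrite andbT.
  by rewrite -big_mkcond big_pred1_eq.
move=> [F' T'] _ /=; case: ifPn => [tT1|tT1]; last first.
  have h : (T' == t |: T) = false by apply: contraNF tT1 => /eqP->; rewrite setU11.
  by rewrite !xpair_eqE h !andbF /= subr0.
rewrite !xpair_eqE tT' //; case: (eqVneq T' (t |: T)) => [->|]; last first.
  by rewrite !andbF /= mulr0n !subr0 !mulr0.
rewrite !andbT sgnUself mulrCA !mulrBr; congr (_ - _).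
  by rewrite eq_sym; case: eqVneq => [->|_]; rewrite ?mulr0 // mulrCA.
have [fe|/hf[_ dj' _]] := eqVneq (f F' (t |: T)) 0.
  rewrite fe mul0r mulr0; case: ifP => // /andP[/eqP e _].
  by rewrite -e fe mulr0.
have tF' : t \notin F' by rewrite (disjointFl dj') ?setU11.
have -> : (F == t |: F') = (F' == F :\ t) && (t \in F).
  apply/eqP/andP => [->|[/eqP-> tF]]; last by rewrite setD1K.
  by rewrite setU1K ?setU11.
by case: ifP => [/andP[/eqP<- _]|_]; rewrite ?mulr1 ?mulr0 ?mulr0.
Qed.

Lemma cvec_cobd i f : chain Delta i f ->
  bdmx i *m cvec i f = cvec i.+1 (cobd f).
Proof.
move=> hf; apply/colP => p; rewrite !mxE.
under eq_bigr do rewrite !mxE mulrC.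
rewrite (chain_sum (fun c => bd_coef (enum_val p) c)) //.
case: (enum_val p) (enum_valP p) => F T /cellsP[/= FD dj _] {p}.
rewrite /cobd dj.
under eq_bigr do rewrite /bd_coef mulr_sumr.
rewrite exchange_big /=; apply: eq_bigr => t tT.
under eq_bigr => c do rewrite mulrCA.
rewrite -mulr_sumr; congr (_ * _).
under eq_bigr => c do rewrite mulrBr mulrnAr -mulrnAr.
rewrite sumrB; congr (_ - _).
  rewrite (bigD1 (F, T :\ t)) //= eqxx mulr1n mulrC big1 ?addr0 // => c h.
  by rewrite (negPf h) mulr0n mulr0.
rewrite (bigD1 (t |: F, T :\ t)) //= eqxx mulr1 big1 ?addr0 // => c h.
by rewrite (negPf h) mulr0.
Qed.

End Matrices.

Section Monomials.
Variables (n : nat) (k : fieldType).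
Local Notation S := {mpoly k[n]}.
Implicit Types (p : S) (m : 'X_{1..n}) (F T : {set 'I_n}) (u t : 'I_n).

Definition setm F : 'X_{1..n} := [multinom nat_of_bool (i \in F) | i < n].

Definition msup m : {set 'I_n} := [set i | m i != 0%N].

Lemma setmE F i : setm F i = (i \in F). Proof. exact: mnmE. Qed.

Lemma setm0 : setm set0 = 0%MM.
Proof. by apply/mnmP => i; rewrite setmE inE mnm0E. Qed.

Lemma setmU1 t F : t \notin F -> setm (t |: F) = (U_(t) + setm F)%MM.
Proof.
move=> tF; apply/mnmP => i; rewrite mnmDE !setmE mnm1E !inE eq_sym.
by case: eqVneq => [<-|//]; rewrite (negPf tF).
Qed.

Lemma setm_le F m : (setm F <= m)%MM = (F \subset msup m).
Proof.
apply/mnm_lepP/subsetP => h i; first by move=> iF; have := h i; rewrite setmE iF inE lt0n.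
by rewrite setmE; case iF: (i \in F) => //; have := h i iF; rewrite inE lt0n.
Qed.

Lemma sqfree_monomialE F : sqfree_monomial k F = 'X_[setm F].
Proof.
rewrite /sqfree_monomial mprodXE; congr 'X_[_]; apply/mnmP => i.
rewrite mnm_sumE setmE (eq_bigr (fun j => (i == j) : nat)); last first.
  by move=> j _; rewrite mnm1E eq_sym.
have [iF|iF] := boolP (i \in F).
  by rewrite (bigD1 i) //= eqxx big1 // => j /andP[_ ji]; rewrite eq_sym (negPf ji).
by rewrite big1 // => j jF; case: eqVneq jF iF => // -> ->.
Qed.

Lemma mcoeffMXE p m m' :
  (p * 'X_[m])@_m' = if (m <= m')%MM then p@_(m' - m) else 0.
Proof.
case: ifPn => [h|h]; first by rewrite -[in LHS](submK h) addmC mcoeffMX.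
apply/eqP; rewrite -[_ == 0]negbK -mcoeff_msupp; apply: contra h.
by rewrite (perm_mem (msuppMX _ _)) => /mapP[m1 _ ->]; rewrite lem_addr.
Qed.

Lemma mcoeff_sumX (I : Type) (r : seq I) (P : pred I) (a : I -> k)
    (f : I -> 'X_{1..n}) m :
  (\sum_(i <- r | P i) a i *: 'X_[f i] : S)@_m =
  \sum_(i <- r | P i) a i *+ (f i == m).
Proof.
rewrite raddf_sum; apply: eq_bigr => i _ /=.
by rewrite mcoeffZ mcoeffX mulr_natr.
Qed.

Definition mfilter (P : pred 'X_{1..n}) p : S :=
  \sum_(m <- msupp p | P m) p@_m *: 'X_[m].

Lemma mcoeff_filter P p m : (mfilter P p)@_m = if P m then p@_m else 0.
Proof.
rewrite mcoeff_sumX big_mkcond /=.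
have [mp|mp] := boolP (m \in msupp p); last first.
  rewrite (memN_msupp_eq0 mp) if_same big_seq big1 // => m' hm.
  case: ifP => // _; case: eqVneq hm mp => [-> -> //|_]; by rewrite mulr0n.
rewrite (bigD1_seq m) ?msupp_uniq //= eqxx big1 ?addr0 // => m' /negPf ->.
by rewrite mulr0n if_same.
Qed.

Lemma mfilterB P : {morph mfilter P : p q / p - q}.
Proof.
move=> p q; apply/mpolyP => m; rewrite mcoeffB !mcoeff_filter mcoeffB.
by case: ifP => // _; rewrite subr0.
Qed.

HB.instance Definition _ (P : pred 'X_{1..n}) :=
  GRing.isAdditive.Build S S (mfilter P) (mfilterB P).

(** Monomials without x_u are dropped. This operator takes the place of the abstract [q u] of the
    contraction. *)
Definition divX u p : S := \sum_(m <- msupp p | m u != 0%N) p@_m *: 'X_[m - U_(u)].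

Lemma mcoeff_divX u p m : (divX u p)@_m = p@_(m + U_(u)).
Proof.
rewrite mcoeff_sumX.
have e (m' : 'X_{1..n}) : m' u != 0%N ->
    ((m' - U_(u))%MM == m) = (m' == (m + U_(u))%MM).
  rewrite -lep1mP => h; apply/eqP/eqP => [<-|->]; first by rewrite submK.
  exact: addmK.
under eq_bigr => i h do rewrite e //.
have [mp|mp] := boolP ((m + U_(u))%MM \in msupp p); last first.
  rewrite (memN_msupp_eq0 mp) big_seq_cond big1 // => m' /andP[hm _].
  by case: eqVneq hm mp => [-> -> //|_]; rewrite mulr0n.
rewrite big_mkcond (bigD1_seq (m + U_(u))%MM) ?msupp_uniq //= eqxx big1 ?addr0.
  by rewrite mnmDE mnm1E eqxx addn1.
by move=> m' /negPf ->; rewrite mulr0n if_same.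
Qed.

Fact divX_additive u : {morph divX u : p q / p - q}.
Proof. by move=> p q; apply/mpolyP => m; rewrite mcoeffB !mcoeff_divX mcoeffB. Qed.

HB.instance Definition _ u := GRing.isAdditive.Build S S (divX u) (divX_additive u).

Lemma mcoeffXM t p m :
  ('X_t * p)@_m = if m t != 0%N then p@_(m - U_(t)) else 0.
Proof. by rewrite mulrC mcoeffMXE lep1mP. Qed.

Lemma divXK u p : divX u ('X_u * p) = p.
Proof.
apply/mpolyP => m; rewrite mcoeff_divX mcoeffXM mnmDE mnm1E eqxx addn1 /=.
by rewrite addmK.
Qed.

Lemma divXC u t p : u != t -> divX u ('X_t * p) = 'X_t * divX u p.
Proof.
move=> ut; apply/mpolyP => m; rewrite mcoeff_divX !mcoeffXM mcoeff_divX.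
rewrite mnmDE mnm1E (negPf ut) addn0; case: ifP => // mt.
by rewrite [in RHS]addmC addmBA ?lep1mP // addmC.
Qed.

Lemma divX_divX u t p : divX u (divX t p) = divX t (divX u p).
Proof.
by apply/mpolyP => m; rewrite !mcoeff_divX -!addmA [(U_(t) + _)%MM]addmC.
Qed.

End Monomials.

Section Ideal.
Variables (n : nat) (k : fieldType) (Delta : {set {set 'I_n}}).
Hypothesis Delta_closed : forall F G : {set 'I_n},
  F \in Delta -> G \subset F -> G \in Delta.
Local Notation S := {mpoly k[n]}.
Local Notation I := (@SR_ideal n k Delta).

Lemma SR_pi0 (p : S) : SR_pi Delta p = 0 <-> p \in I.
Proof.
have e0 : SR_pi Delta 0 = 0 :> SR k Delta.
  by apply: (addIr (SR_pi Delta 0)); rewrite add0r -SR_piD addr0.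
rewrite -e0 -[p in p \in I]subr0; split; last exact: SR_pi_eq.
by rewrite Quotient.idealrBE => /eqP.
Qed.

Lemma nonface_ideal F (p : S) : F \notin Delta -> p * 'X_[setm F] \in I.
Proof.
move=> FD; apply: SR_idealM; apply/asboolP.
exists (fun G => (G == F)%:R); rewrite (bigD1 F) //= eqxx mul1r sqfree_monomialE.
by rewrite big1 ?addr0 // => G /andP[_ /negPf ->]; rewrite mul0r.
Qed.

Lemma SR_ideal_msup (p : S) m : p \in I -> msup m \in Delta -> p@_m = 0.
Proof.
move=> /asboolP[c ->] mD; rewrite raddf_sum big1 //= => F FD.
rewrite sqfree_monomialE mcoeffMXE setm_le; case: ifPn => // h.
by rewrite (Delta_closed mD h) in FD.
Qed.

End Ideal.

Section SRResolution.
Variables (n : nat) (k : fieldType) (Delta : {set {set 'I_n}}).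
Hypothesis Delta_closed : forall F G : {set 'I_n},
  F \in Delta -> G \subset F -> G \in Delta.
Hypothesis Delta0 : set0 \in Delta.
Local Notation S := {mpoly k[n]}.
Local Notation I := (@SR_ideal n k Delta).
Local Notation X := (fun t : 'I_n => 'X_t : S).
Implicit Types (F T : {set 'I_n}) (f g : {set 'I_n} -> {set 'I_n} -> S).

Definition aug_poly f : S := \sum_(F in Delta) f F set0 * 'X_[setm F].

Definition SR_aug (v : 'rV[S]_#|cells Delta 0|) : SR k Delta :=
  SR_pi Delta (\sum_p v 0 p * 'X_[setm (enum_val p).1]).

Fact SR_aug_linear : linear SR_aug.
Proof.
move=> a u v; rewrite /SR_aug.
rewrite [X in _ = X + _](_ : _ =
    SR_pi Delta (a * \sum_p u 0 p * 'X_[setm (enum_val p).1])).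
  rewrite -SR_piD; congr (SR_pi _ _); rewrite mulr_sumr -big_split.
  by apply: eq_bigr => p _; rewrite !mxE mulrDl mulrA.
exact: SR_scaleE.
Qed.

HB.instance Definition _ := GRing.isLinear.Build S 'rV[S]_#|cells Delta 0|
  (SR k Delta) _ SR_aug SR_aug_linear.

Lemma SR_aug_vec f : chain Delta 0 f ->
  SR_aug (vec Delta 0 f) = SR_pi Delta (aug_poly f).
Proof.
move=> hf; congr SR_pi.
under eq_bigr do rewrite mxE.
rewrite (chain_sum (fun c => 'X_[setm c.1])) //.
rewrite -(pair_bigA _ (fun F T => f F T * 'X_[setm F])) /= /aug_poly.
rewrite [RHS]big_mkcond; apply: eq_bigr => F _.
case: ifPn => FD.
  rewrite (bigD1 set0) //= big1 ?addr0 // => T T0.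
  rewrite (_ : f F T = 0) ?mul0r //; apply: contra_neq_eq T0 => /hf[_ _ /eqP].
  by rewrite cards_eq0 => /eqP.
rewrite big1 // => T _; rewrite (_ : f F T = 0) ?mul0r //.
by apply: contraNeq FD => /hf[].
Qed.

(** Both terms of the differential of e_(F, {t}) map to the monomial of [t |: F] and cancel when
    this is a face. Otherwise only the first term is present, and its image lies in the ideal. *)
Lemma aug_poly_bd g : chain Delta 1 g -> aug_poly (bd X Delta g) \in I.
Proof.
move=> hg.
have -> : aug_poly (bd X Delta g) =
    \sum_(t : 'I_n) \sum_(F : {set 'I_n} |
        (t \notin F) && (F \in Delta) && (t |: F \notin Delta))
      g F [set t] * 'X_[setm (t |: F)].
  transitivity (\sum_(F in Delta) \sum_t ('X_t * g F [set t] * 'X_[setm F]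
       - g (F :\ t) [set t] *+ (t \in F) * 'X_[setm F])).
    apply: eq_bigr => F FD; rewrite /bd FD mulr_suml.
    rewrite big_mkcond; apply: eq_bigr => t _; rewrite inE /=.
    rewrite /sgn (_ : [set _ in set0 | _] = set0); last first.
      by apply/setP => i; rewrite !inE.
    by rewrite cards0 mul1r setU0 mulrBl.
  rewrite exchange_big; apply: eq_bigr => t _; rewrite sumrB.
  apply/eqP; rewrite subr_eq; apply/eqP.
  rewrite [X in _ = _ + X](eq_bigr (fun F =>
     if t \in F then g (F :\ t) [set t] * 'X_[setm F] else 0)); last first.
    by move=> F _; case: (t \in F); rewrite ?mulr1n // mulr0n mul0r.
  rewrite -[X in _ = _ + X]big_mkcondr /=.
  rewrite [X in _ = _ + X](reindex_onto (fun F => t |: F) 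
    (fun F => F :\ t)) /=; last first.
    by move=> F /andP[_ tF]; rewrite setD1K.
  have eF F : ((t |: F \in Delta) && (t \in t |: F)) && ((t |: F) :\ t == F) =
     (t \notin F) && (F \in Delta) && (t |: F \in Delta).
    rewrite setU11 andbT.
    have -> : ((t |: F) :\ t == F) = (t \notin F).
      apply/eqP/idP => [<-|]; first by rewrite !inE eqxx.
      exact: setU1K.
    rewrite andbC -andbA; congr (_ && _).
    case FD: (t |: F \in Delta); last by rewrite andbF.
    by rewrite andbT (Delta_closed FD) // subsetUr.
  rewrite (eq_bigl _ _ eF) addrC.
  rewrite [X in _ = X + _](eq_bigr (fun F => g F [set t] * 'X_[setm (t |: F)]));
    last first.
    by move=> F /andP[/andP[tF _] _]; rewrite setU1K.
  rewrite -[RHS](bigID (fun F => t |: F \in Delta)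
    (fun F => (t \notin F) && (F \in Delta))
    (fun F => g F [set t] * 'X_[setm (t |: F)])) /=.
  rewrite [LHS]big_mkcond [RHS]big_mkcond; apply: eq_bigr => F _.
  case FD: (F \in Delta); rewrite ?andbF // andbT; case: ifPn => [tF|].
    by rewrite setmU1 // mpolyXD mulrA [X in X * _]mulrC.
  rewrite negbK => tF; rewrite (_ : g F _ = 0) ?mulr0 ?mul0r //.
  apply: contraTeq tF => /hg[_ dj _].
  by rewrite (disjointFl dj) // set11.
apply: rpred_sum => t _; apply: rpred_sum => F /andP[_ FD].
exact: nonface_ideal.
Qed.

Lemma aug_polyB f g :
  aug_poly (fun F T => f F T - g F T) = aug_poly f - aug_poly g.
Proof. by rewrite /aug_poly -sumrB; apply: eq_bigr => F _; rewrite mulrBl. Qed.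

(** By the hypothesis on [divX], [f F set0] involves only the variables of F, so its product with
    the monomial of F has only monomials of support exactly F, and different faces do not interfere.
    A member of the ideal has no monomial supported on a face. *)
Lemma aug_poly_inj f : chain Delta 0 f ->
  (forall u F T, u \notin F -> divX u (f F T) = 0) ->
  aug_poly f \in I -> forall F T, f F T = 0.
Proof.
move=> hf df fI F T; have [//|nz] := eqVneq (f F T) 0.
have [FD dj /eqP] := hf _ _ nz; rewrite cards_eq0 => /eqP T0.
rewrite {T dj nz}T0.
have z (G : {set 'I_n}) (m : 'X_{1..n}) u : u \notin G -> m u != 0%N -> (f G set0)@_m = 0.
  move=> uG mu; rewrite -(@submK _ U_(u) m) ?lep1mP // -mcoeff_divX.
  by rewrite df // mcoeff0.
apply/mpolyP => m; rewrite mcoeff0.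
have [|] := boolP [exists u, (u \notin F) && (m u != 0%N)].
  by case/existsP => u /andP[]; apply: z.
rewrite negb_exists => /forallP h.
have mF : msup (m + setm F) = F.
  apply/setP => i; rewrite inE mnmDE setmE addn_eq0 negb_and.
  have := h i; rewrite negb_and !negbK => /orP[->|/eqP->] /=.
    by rewrite orbT.
  by case: (i \in F).
have := SR_ideal_msup Delta_closed (m := (m + setm F)%MM) fI.
rewrite mF FD raddf_sum (bigD1 F) //= mcoeffMXE lem_addl addmK => /(_ isT).
rewrite big1 ?addr0 // => G /andP[GD GF]; rewrite mcoeffMXE.
case: ifP => //; rewrite setm_le mF => GsF.
have /subsetPn[u uF uG] : ~~ (F \subset G).
  by apply: contra GF => FG; rewrite eqEsubset GsF.
apply: (z _ _ u uG); rewrite mnmBE mnmDE !setmE uF (negPf uG).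
by rewrite subn0 addn1.
Qed.

Lemma SR_aug_surj (y : SR k Delta) : exists v, SR_aug v = y.
Proof.
have [p ->] := SR_piP y.
pose f F T : S := if (F == set0) && (T == set0) then p else 0.
exists (vec Delta 0 f); rewrite SR_aug_vec.
  rewrite /aug_poly (bigD1 set0) //= big1 ?addr0 => [|F /andP[_ /negPf F0]].
    by rewrite /f eqxx setm0 mpolyX0 mulr1.
  by rewrite /f F0 mul0r.
move=> F T; rewrite /f; case: ifP => [/andP[/eqP-> /eqP->] _|]; last by rewrite eqxx.
by rewrite cards0 -setI_eq0 setI0.
Qed.

Lemma SR_res_exact i (f : {set 'I_n} -> {set 'I_n} -> S) : chain Delta i f ->
  (forall F T, bd X Delta f F T = 0) ->
  (i = 0%N -> aug_poly f \in I) ->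
  exists w, vec Delta i f = w *m bdmx X Delta i.
Proof.
move=> hf cf f0.
have [g [hg g1 g2]] := bd_reduce Delta_closed (q := fun u => divX u : {additive S -> S})
  (@divXK n k) (@divXC n k) (@divX_divX n k) hf cf.
exists (vec Delta i.+1 g); rewrite vec_bd //; apply/vecP => //.
  exact: bd_chain.
move=> F T; apply/eqP; rewrite -subr_eq0; apply/eqP.
have hfg : chain Delta i (fun F T => f F T - bd X Delta g F T).
  by apply: chainB => //; apply: bd_chain.
(* For positive i the reduced cycle vanishes outright, since only [T = set0] is left and its
   cardinality is wrong; in degree 0 the augmentation decides. *)
case: i => [|i] in hf f0 hg hfg *.
  apply: (aug_poly_inj hfg) => //; rewrite aug_polyB rpredB ?f0 //.
  exact: aug_poly_bd.
have [T0|/g1-> //] := eqVneq T set0.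
apply/eqP; apply: contraT => /hfg[_ _].
by rewrite T0 cards0.
Qed.

Lemma SR_aug_exact v : SR_aug v = 0 <-> exists w, v = w *m bdmx X Delta 0.
Proof.
have [f hf ->] := vec_surj v; split=> [|[w ->]].
  rewrite SR_aug_vec // => /SR_pi0 h; apply: SR_res_exact => //.
  exact: bd_chain0.
have [g hg ->] := vec_surj w; rewrite vec_bd // SR_aug_vec; last exact: bd_chain.
exact/SR_pi0/aug_poly_bd.
Qed.

Lemma SR_diff_exact i (v : 'rV[S]_#|cells Delta i.+1|) :
  v *m bdmx X Delta i = 0 <-> exists w, v = w *m bdmx X Delta i.+1.
Proof.
have [f hf ->] := vec_surj v.
have c0 j : chain Delta j (fun _ _ => 0 : S) by move=> F T; rewrite eqxx.
have v0 j : vec Delta j (fun _ _ => 0) = 0 :> 'rV[S]_#|cells Delta j|.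
  by apply/rowP => p; rewrite !mxE.
split=> [|[w ->]].
  rewrite vec_bd // -v0 vecP //; last exact: bd_chain.
  by move=> h; apply: SR_res_exact.
have [g hg ->] := vec_surj w; rewrite !vec_bd //; last exact: bd_chain.
rewrite -v0 vecP // => [F T|]; last by do 2 apply: bd_chain.
exact: bd_bd.
Qed.

Definition SR_resolution : free_resolution (SR k Delta) :=
  @FreeResolution S (SR k Delta) (fun i => #|cells Delta i|)
    (bdmx X Delta) SR_aug SR_aug_surj SR_aug_exact SR_diff_exact.

End SRResolution.

(** * Graded Betti numbers *)

Section Graded.
Variables (n : nat) (k : fieldType).
Local Notation S := {mpoly k[n]}.
Implicit Types (d e : int) (p r : S) (m : 'X_{1..n}).

(** Uniform in the sign of d: for d < 0 it forces p = 0, as [mpoly_piece] does. *)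
Definition homdeg d p := forall m, p@_m != 0 -> (mdeg m)%:Z = d.

Definition hproj d p : S := mfilter (fun m => (mdeg m)%:Z == d) p.

Lemma mcoeff_hproj d p m : (hproj d p)@_m = if (mdeg m)%:Z == d then p@_m else 0.
Proof. exact: mcoeff_filter. Qed.

Lemma hprojB d : {morph hproj d : p r / p - r}.
Proof. exact: mfilterB. Qed.

HB.instance Definition _ d := GRing.isAdditive.Build S S (hproj d) (hprojB d).

Lemma hproj_homdeg d p : homdeg d (hproj d p).
Proof. by move=> m; rewrite mcoeff_hproj; case: ifP => [/eqP //|_]; rewrite eqxx. Qed.

Lemma hproj_id d p : homdeg d p -> hproj d p = p.
Proof.
move=> hp; apply/mpolyP => m; rewrite mcoeff_hproj; case: ifPn => //.
by have [->|/hp ->] := eqVneq p@_m 0; rewrite ?eqxx.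
Qed.

Lemma hprojM d e p r : homdeg e r -> hproj d (p * r) = hproj (d - e) p * r.
Proof.
move=> hr; rewrite (mpolyE r) !mulr_sumr raddf_sum big_seq [RHS]big_seq.
apply: eq_bigr => m hm; rewrite -!scalerAr; apply/mpolyP => m'.
rewrite /= mcoeff_hproj !mcoeffZ !mcoeffMXE.
have dm : (mdeg m)%:Z = e by apply: hr; rewrite -mcoeff_msupp.
case: (boolP (m <= m')%MM) => h; last by rewrite mulr0 if_same.
rewrite mcoeff_hproj -dm -{1}(submK h) mdegD PoszD.
by rewrite [_ == d - _]eq_sym subr_eq eq_sym; case: ifP; rewrite ?mulr0.
Qed.

Lemma homdeg_piece d p : mpoly_piece d p -> homdeg d p.
Proof.
case: d => d /=; last by move=> /eqP -> m; rewrite mcoeff0 eqxx.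
by move=> /dhomogP h m; rewrite -mcoeff_msupp => /h ->.
Qed.

Lemma homdegB d p r : homdeg d p -> homdeg d r -> homdeg d (p - r).
Proof.
by move=> hp hr; rewrite -(hproj_id hp) -(hproj_id hr) -hprojB; apply: hproj_homdeg.
Qed.

Lemma homdeg_setm (F : {set 'I_n}) : homdeg #|F| 'X_[setm F].
Proof.
move=> m; rewrite mcoeffX; case: (eqVneq (setm F) m) => [<- _|_]; last by rewrite eqxx.
congr Posz; rewrite mdegE -sum1_card [RHS]big_mkcond /=.
by apply: eq_bigr => i _; rewrite setmE; case: (i \in F).
Qed.

Lemma hproj_ideal (Delta : {set {set 'I_n}}) d p :
  p \in SR_ideal Delta -> hproj d p \in SR_ideal Delta.
Proof.
case/asboolP => c ->; rewrite raddf_sum; apply: rpred_sum => F FD /=.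
rewrite sqfree_monomialE (hprojM _ _ (@homdeg_setm F)).
exact: nonface_ideal.
Qed.

Section GradedMatrices.
Variables (a b : nat).
Implicit Types (sa : 'I_a -> int) (sb : 'I_b -> int).

Definition homdeg_mx sa sb (X : 'M[S]_(a, b)) :=
  forall i j, homdeg (sa i - sb j) (X i j).

Definition hproj_mx sa sb (X : 'M[S]_(a, b)) : 'M[S]_(a, b) :=
  \matrix_(i, j) hproj (sa i - sb j) (X i j).

Lemma hproj_mx_homdeg sa sb X : homdeg_mx sa sb (hproj_mx sa sb X).
Proof. by move=> i j; rewrite mxE; apply: hproj_homdeg. Qed.

End GradedMatrices.

Lemma hproj_mxMr a b c sa sb sc (X : 'M[S]_(a, b)) (Y : 'M[S]_(b, c)) :
  homdeg_mx sb sc Y -> hproj_mx sa sc (X *m Y) = hproj_mx sa sb X *m Y.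
Proof.
move=> hY; apply/matrixP => i j; rewrite !mxE raddf_sum; apply: eq_bigr => l _ /=.
by rewrite mxE (hprojM _ _ (hY l j)) opprB addrA subrK.
Qed.

Lemma hproj_mxMl a b c sa sb sc (X : 'M[S]_(a, b)) (Y : 'M[S]_(b, c)) :
  homdeg_mx sa sb X -> hproj_mx sa sc (X *m Y) = X *m hproj_mx sb sc Y.
Proof.
move=> hX; apply/matrixP => i j; rewrite !mxE raddf_sum; apply: eq_bigr => l _ /=.
rewrite mxE mulrC (hprojM _ _ (hX i l)) mulrC; congr (_ * hproj _ _).
by rewrite opprB addrC addrA subrK.
Qed.

End Graded.

(** * Homogeneous comparison maps and their reduction modulo the variables *)

Section GradedComparison.
Variables (n : nat) (k : fieldType) (Delta : {set {set 'I_n}}).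
Local Notation S := {mpoly k[n]}.
Local Notation M := (SR k Delta).

Record graded_by (A : free_resolution M) (s : forall i, 'I_(rk A i) -> int) :=
  GradedBy {
  gb_aug : forall q, exists2 p : S, homdeg (s 0%N q) p &
    aug A (delta_mx 0 q) = SR_pi Delta p;
  gb_diff : forall i, homdeg_mx (s i.+1) (s i) (diff A i)
}.

Arguments gb_diff {A s} g i : rename.

(** Any chain map becomes homogeneous once each entry is truncated to its expected degree:
    truncation commutes with multiplication by the homogeneous differentials, and it respects the
    augmentations because the ideal is homogeneous. *)
Lemma graded_chain_map A B sA sB : @graded_by A sA -> @graded_by B sB ->
  exists phi : chain_map A B, forall i, homdeg_mx (sA i) (sB i) (cmap phi i).
Proof.
move=> gA gB; have [phi] := chain_map_exists A B.
pose psi i := hproj_mx (sA i) (sB i) (cmap phi i).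
have ed i : diff A i *m psi i = psi i.+1 *m diff B i.
  rewrite /psi -(hproj_mxMl _ _ (gb_diff gA i)) -(hproj_mxMr _ _ (gb_diff gB i)).
  by rewrite cmap_diff.
have ea v : aug B (v *m psi 0%N) = aug A v.
  rewrite mulmx_sum_row linear_sum [in RHS](row_sum_delta v) linear_sum.
  apply: eq_bigr => p _; rewrite !linearZ /=; congr (_ *: _).
  have : aug B (row p (cmap phi 0)) = aug A (delta_mx 0 p).
    by rewrite rowE cmap_aug.
  have [s hs ->] := gb_aug gA p.
  pose r q := sval (cid2 (gb_aug gB q)).
  have hr q : homdeg (sB 0%N q) (r q) by rewrite /r; case: cid2.
  have er q : aug B (delta_mx 0 q) = SR_pi Delta (r q) by rewrite /r; case: cid2.
  have augE (w : 'rV[S]_(rk B 0)) : aug B w = SR_pi Delta (\sum_q w 0 q * r q).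
    rewrite {1}(row_sum_delta w) linear_sum.
    elim/big_rec2: _ => [|q x y _ IH].
      by apply/esym/SR_pi0; rewrite rpred0.
    rewrite SR_piD -IH linearZ /= er; congr (_ + _).
    exact: SR_scaleE.
  rewrite !augE => /eqP; rewrite -Quotient.idealrBE => h.
  apply: SR_pi_eq; rewrite -[s](hproj_id hs).
  rewrite (_ : _ - _ = hproj (sA 0%N p)
      (\sum_q (row p (cmap phi 0)) 0 q * r q - s)); first exact: hproj_ideal.
  rewrite hprojB; congr (_ - _).
  rewrite raddf_sum; apply: eq_bigr => q _ /=.
  by rewrite (hprojM _ _ (hr q)) !mxE.
exists (ChainMap ea ed) => i; exact: hproj_mx_homdeg.
Qed.


Local Notation red := (map_mx (mcoeff 0%MM : S -> k)).

(** The constant term of a homogeneous entry vanishes unless the degrees of source and target agree,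
    so the reduced comparison maps preserve degrees. No degrees are recorded for the homotopies,
    which only serve to recognise boundaries. *)
Lemma graded_homotopy_equiv A B sA sB : @graded_by A sA -> @graded_by B sB ->
  exists (phi : forall i, 'M[k]_(rk A i, rk B i))
         (psi : forall i, 'M[k]_(rk B i, rk A i))
         (h : forall i, 'M[k]_(rk A i, rk A i.+1))
         (h' : forall i, 'M[k]_(rk B i, rk B i.+1)),
  [/\ forall i p q, phi i p q != 0 -> sA i p = sB i q,
      forall i p q, psi i p q != 0 -> sB i p = sA i q,
      (forall i, red (diff A i) *m phi i = phi i.+1 *m red (diff B i)) /\
      (forall i, red (diff B i) *m psi i = psi i.+1 *m red (diff A i)),
      1%:M - phi 0%N *m psi 0%N = h 0%N *m red (diff A 0) /\
      (forall i, 1%:M - phi i.+1 *m psi i.+1 =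
         red (diff A i) *m h i + h i.+1 *m red (diff A i.+1)) &
      1%:M - psi 0%N *m phi 0%N = h' 0%N *m red (diff B 0) /\
      (forall i, 1%:M - psi i.+1 *m phi i.+1 =
         red (diff B i) *m h' i + h' i.+1 *m red (diff B i.+1))].
Proof.
move=> gA gB.
have [phi hphi] := graded_chain_map gA gB.
have [psi hpsi] := graded_chain_map gB gA.
have [h] := homotopy_inverse phi psi; have [h'] := homotopy_inverse psi phi.
have hom0 (a b : nat) (sa : 'I_a -> int) (sb : 'I_b -> int) (Z : 'M[S]_(a, b)) :
    homdeg_mx sa sb Z -> forall p q, red Z p q != 0 -> sa p = sb q.
  move=> hZ p q; rewrite mxE => /hZ; rewrite mdeg0 => /esym/eqP.
  by rewrite subr_eq0 => /eqP.
exists (fun i => red (cmap phi i)), (fun i => red (cmap psi i)).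
exists (fun i => red (hmap h i)), (fun i => red (hmap h' i)).
split; first by move=> i; apply: hom0.
- by move=> i; apply: hom0.
- by split=> i; rewrite -!map_mxM cmap_diff.
- split=> [|i]; rewrite -(map_mx1 (mcoeff 0%MM : {rmorphism S -> k})) -!map_mxM
    -map_mxB ?(hmap0 h) ?(hmapS h) ?map_mxD //.
- split=> [|i]; rewrite -(map_mx1 (mcoeff 0%MM : {rmorphism S -> k})) -!map_mxM
    -map_mxB ?(hmap0 h') ?(hmapS h') ?map_mxD //.
Qed.

End GradedComparison.

(** * Betti numbers as homology of squarefree strands *)

Section Betti.
Variables (n : nat) (k : fieldType) (Delta : {set {set 'I_n}}).
Hypothesis Delta_closed : forall F G : {set 'I_n},
  F \in Delta -> G \subset F -> G \in Delta.
Hypothesis Delta0 : set0 \in Delta.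
Local Notation S := {mpoly k[n]}.
Local Notation X := (fun t : 'I_n => 'X_t : S).
Local Notation P := (SR_resolution k Delta_closed Delta0).
Local Notation red := (map_mx (mcoeff 0%MM : S -> k)).
Local Notation bd_mod := (bd (fun _ : 'I_n => 0 : k) Delta).
Implicit Types (F T W : {set 'I_n}).

Definition cell_deg i (p : 'I_#|cells Delta i|) : int :=
  (#|(enum_val p).1| + #|(enum_val p).2|)%N.

Lemma homdeg_coef (c c' : {set 'I_n} * {set 'I_n}) (d : int) : [disjoint c.1 & c.2] ->
  d = (#|c.1| + #|c.2|)%N%:Z - (#|c'.1| + #|c'.2|)%N%:Z ->
  homdeg d (@bd_coef n S X c c').
Proof.
move=> dj ->; rewrite /bd_coef; set d' := (X in homdeg X _).
rewrite (_ : \sum_(t in c.2) _ = hproj d' (\sum_(t in c.2) sgn S t c.2 *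
    ('X_t *+ (c' == (c.1, c.2 :\ t)) - (c' == (t |: c.1, c.2 :\ t))%:R))).
  exact: hproj_homdeg.
rewrite raddf_sum; apply: eq_bigr => t tc /=; rewrite hproj_id //.
move=> m; rewrite {1}/sgn -signr_odd mulr_sign; move: m.
have hN (p : S) : homdeg d' p -> homdeg d' (- p).
  by move=> hp m; rewrite mcoeffN oppr_eq0; apply: hp.
suff hh : homdeg d' (('X_t *+ (c' == (c.1, c.2 :\ t)) : S)
    - (c' == (t |: c.1, c.2 :\ t))%:R).
  by case: odd => //; apply: hN.
have cT : #|c.2| = #|c.2 :\ t|.+1 by rewrite (cardsD1 t) tc.
apply: homdegB => m.
  case: (eqVneq c' (c.1, c.2 :\ t)) => [e|_]; last by rewrite mulr0n mcoeff0 eqxx.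
  rewrite mulr1n mcoeffX; case: (eqVneq U_(t)%MM m) => [<- _|_]; last by rewrite eqxx.
  by rewrite mdeg1 /d' e cT /=; apply/esym/eqP; rewrite subr_eq -PoszD add1n addnS.
case: (eqVneq c' (t |: c.1, c.2 :\ t)) => [e|_]; last by rewrite mcoeff0 eqxx.
rewrite mcoeff1; case: (eqVneq m 0%MM) => [-> _|_]; last by rewrite eqxx.
have tF : t \notin c.1 by rewrite (disjointFl dj).
by rewrite mdeg0 /d' e cT /= cardsU1 tF addnS subrr.
Qed.

Lemma SR_resolution_graded : @graded_by n k Delta P cell_deg.
Proof.
split=> [q|i p q]; last first.
  rewrite /= mxE; case/cellsP: (enum_valP p) => _ dj _.
  exact: homdeg_coef.
exists 'X_[setm (enum_val q).1].
  have /cellsP[_ _ e] := enum_valP q.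
  by rewrite /cell_deg e addn0; apply: homdeg_setm.
rewrite /= /SR_aug (bigD1 q) //= mxE !eqxx mul1r big1 ?addr0 // => p /negPf pq.
by rewrite mxE pq andbF mul0r.
Qed.

Lemma min_resolution_graded (A : min_graded_free_resolution (@SR_piece n k Delta)) :
  @graded_by n k Delta A (@shift _ _ _ _ A).
Proof.
split=> [q|i p q]; last exact/homdeg_piece/diff_graded.
have [p hp ->] := aug_graded q; exists p => //; exact: homdeg_piece.
Qed.

Lemma red_bdmx i : red (bdmx X Delta i) = bdmx (fun _ => 0) Delta i.
Proof.
apply/matrixP => p q; rewrite !mxE raddf_sum; apply: eq_bigr => t _ /=.
rewrite rmorphM rmorph_sign; congr (_ * _).
rewrite rmorphB rmorphMn rmorph_nat; congr (_ *+ _ - _).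
by rewrite /= mcoeffX mnm1_eq0.
Qed.

(* Homology of the resolution modulo the variables, in squarefree degree W. *)
Definition strand_nontrivial i W := exists f : {set 'I_n} -> {set 'I_n} -> k,
  [/\ chain Delta i f, forall F T, f F T != 0 -> F :|: T = W,
      forall F T, bd_mod f F T = 0 &
      ~ exists2 g, chain Delta i.+1 g & f =2 bd_mod g].

(** The cycle condition is expressed through functions because no matrix [bdmx] leaves homological
    degree 0, where [bd_mod] vanishes on chains by itself. *)
Definition betti_class i (d : int) := exists z : 'rV[k]_#|cells Delta i|,
  [/\ forall q, z 0 q != 0 -> cell_deg q = d,
      forall f, z = vec Delta i f -> chain Delta i f -> forall F T, bd_mod f F T = 0 &
      ~ exists w, z = w *m bdmx (fun _ => 0) Delta i].

(** By minimality the differentials of A vanish modulo the variables, so [phi i *m psi i] is the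
    identity. A generator of degree d therefore maps to a cycle that is no boundary. Conversely, if
    [z *m psi i] were 0, the homotopy would make z a boundary; a nonzero entry points to a generator
    of degree d. *)
Lemma betti_classP (A : min_graded_free_resolution (@SR_piece n k Delta)) i d :
  betti A i d <> 0%N <-> betti_class i d.
Proof.
have [phi [psi [h [h' [hphi hpsi [cphi cpsi] [h0 hS] [h0' hS']]]]]] :=
  graded_homotopy_equiv (min_resolution_graded A) SR_resolution_graded.
have dA j : red (diff A j) = 0.
  by apply/matrixP => p q; rewrite !mxE; apply: diff_minimal.
have phipsi j : phi j *m psi j = 1%:M.
  by case: j => [|j]; apply/eqP; rewrite eq_sym -subr_eq0 ?h0 ?hS !dA
     ?mulmx0 ?mul0mx ?addr0.
have cphi' j : phi j.+1 *m bdmx (fun _ => 0) Delta j = 0.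
  by have := cphi j; rewrite dA mul0mx red_bdmx.
have cpsi' j : bdmx (fun _ => 0) Delta j *m psi j = 0.
  by have := cpsi j; rewrite dA mulmx0 red_bdmx.
rewrite /betti; split.
  move=> /eqP; rewrite -lt0n => /card_gt0P[q]; rewrite inE => /eqP sq.
  exists (row q (phi i)); split.
  - by move=> p; rewrite mxE => /hphi <-.
  - case: i q sq => [|i] q sq f e hf F T; first exact: bd_chain0.
    have := congr1 (mulmx^~ (bdmx (fun _ => 0) Delta i)) e.
    rewrite /= -row_mul cphi' row0 vec_bd //.
    have c0 : chain Delta i (fun _ _ => 0 : k) by move=> ? ?; rewrite eqxx.
    move=> e'; suff /(vecP (bd_chain hf) c0) -> :
      vec Delta i (bd_mod f) = vec Delta i (fun _ _ => 0) by [].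
    by rewrite -e'; apply/rowP => p; rewrite !mxE.
  - case=> w e; have := congr1 (mulmx^~ (psi i)) e.
    rewrite /= -mulmxA cpsi' mulmx0 -row_mul phipsi => /rowP/(_ q).
    by rewrite !mxE eqxx => /eqP; rewrite oner_eq0.
case=> z [zd zc zb].
have [q nz] : exists q, (z *m psi i) 0 q != 0.
  apply/existsP; rewrite -negb_forall; apply/negP => /forallP e.
  have {}e : z *m psi i = 0 by apply/rowP => q; rewrite [RHS]mxE; apply/eqP.
  apply: zb; have -> : z = z *m (1%:M - psi i *m phi i).
    by rewrite mulmxBr mulmx1 mulmxA e mul0mx subr0.
  case: i z zd zc e => [|i] z zd zc e.
    by exists (z *m h' 0%N); rewrite h0' red_bdmx mulmxA.
  have [f hf ef] := vec_surj z.
  have zD : z *m bdmx (fun _ => 0) Delta i = 0.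
    rewrite ef vec_bd //; apply/rowP => p; rewrite !mxE; exact: zc.
  exists (z *m h' i.+1); rewrite hS' !red_bdmx mulmxDr !mulmxA.
  by rewrite zD mul0mx add0r.
apply/eqP; rewrite -lt0n; apply/card_gt0P; exists q; rewrite inE.
move: nz; rewrite mxE.
have [p hp|hz] := pickP (fun p => z 0 p * psi i p q != 0).
  move: hp; rewrite mulf_eq0 negb_or => /andP[/zd <- /hpsi ->] _; exact: eqxx.
by rewrite big1 ?eqxx // => p _; apply/eqP/negPn; rewrite hz.
Qed.

(** With x = 0 the differential only moves vertices from T to F, so the union is preserved and the
    complex splits. *)
Lemma bd_mod_local f g F T :
  (forall F' T', F' :|: T' = F :|: T -> f F' T' = g F' T') ->
  bd_mod f F T = bd_mod g F T.
Proof.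
move=> e; rewrite /bd; case: ifP => // FD; apply: eq_bigr => t tT.
congr (_ * _); rewrite !mul0r; congr (_ - _).
case tF: (t \in F) => //; congr (_ *+ _); apply: e.
by rewrite setUA [_ :|: [set t]]setUC setD1K.
Qed.

Lemma betti_strandP (A : min_graded_free_resolution (@SR_piece n k Delta)) i d :
  betti A i d <> 0%N <-> exists2 W : {set 'I_n}, #|W|%:Z = d & strand_nontrivial i W.
Proof.
have cardU F T : [disjoint F & T] -> #|F :|: T| = (#|F| + #|T|)%N.
  by rewrite -setI_eq0 => /eqP e; rewrite -cardsUI e cards0 addn0.
rewrite betti_classP; split.
  case=> z [zd zc zb]; have [f hf ef] := vec_surj z.
  have cf := zc f ef hf.
  pose fW W F T := if F :|: T == W then f F T else 0.
  have hfW W : chain Delta i (fW W).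
    by move=> F T; rewrite /fW; case: ifP => [_ /hf //|_]; rewrite eqxx.
  have bfW W F T : bd_mod (fW W) F T = 0.
    have [e|ne] := eqVneq (F :|: T) W.
      transitivity (bd_mod f F T); last exact: cf.
      apply: bd_mod_local => F' T' e'.
      by rewrite /fW e' e eqxx.
    transitivity (bd_mod (fun _ _ => 0) F T); last exact: bd0.
    apply: bd_mod_local => F' T' e'.
    by rewrite /fW e' (negPf ne).
  apply: contrapT => hno; apply: zb.
  (* A zero strand is the boundary of 0; a nonzero one lies over a W of cardinality d, where [hno]
     excludes homology. *)
  have hg W : exists2 g, chain Delta i.+1 g & fW W =2 bd_mod g.
    apply: contrapT => ng; have nz : exists F T, fW W F T != 0.
      apply: contrapT => hz; apply: ng; exists (fun _ _ => 0).
        by move=> F T; rewrite eqxx.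
      move=> F T; rewrite bd0; apply: contrapT => /eqP h.
      by apply: hz; exists F, T.
    have [F [T]] := nz; rewrite /fW; case: ifP => [/eqP e|_]; last by rewrite eqxx.
    move=> fnz; apply: hno; exists W; last first.
      exists (fW W); split=> // F' T'; rewrite /fW.
      by case: ifP => [/eqP //|_]; rewrite eqxx.
    have FT : (F, T) \in cells Delta i by apply/cellsP; apply: hf.
    rewrite -e cardU; last by case: (hf _ _ fnz).
    rewrite -(zd (enum_rank_in FT (F, T))) /cell_deg ?enum_rankK_in //.
    by rewrite ef mxE enum_rankK_in.
  pose g W := s2val (cid2 (hg W)).
  have g1 W : chain Delta i.+1 (g W) := s2valP (cid2 (hg W)).
  have g2 W : fW W =2 bd_mod (g W) := s2valP' (cid2 (hg W)).
  exists (vec Delta i.+1 (fun F T => g (F :|: T) F T)).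
  have hG : chain Delta i.+1 (fun F T => g (F :|: T) F T).
    by move=> F T /g1.
  rewrite vec_bd // ef; apply/vecP => //; first exact: bd_chain.
  move=> F T; transitivity (fW (F :|: T) F T); first by rewrite /fW eqxx.
  by rewrite g2; apply: bd_mod_local => F' T' ->.
case=> W <- [f [hf fW cf nb]]; exists (vec Delta i f); split.
- move=> q; rewrite mxE => nz; have [_ dj _] := hf _ _ nz.
  by rewrite /cell_deg -cardU // (fW _ _ nz).
- move=> f' /(vecP hf) e hf' F T; transitivity (bd_mod f F T); last exact: cf.
  by apply: bd_eq => F' T'; rewrite e.
- case=> w; have [g hg ->] := vec_surj w; rewrite vec_bd // => e.
  apply: nb; exists g => //; apply/(vecP hf) => //; exact: bd_chain.
Qed.

End Betti.

(** * Chains of primes in a polynomial ring *)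

Section MonomialPrimes.
Variables (n : nat) (k : fieldType).
Local Notation S := {mpoly k[n]}.
Implicit Types (p q s : S) (m : 'X_{1..n}) (U W : {set 'I_n}).

(** For P = [avoid W] the filter substitutes 0 for the variables in W; being multiplicative with
    values in a domain, it has a prime kernel. *)
Lemma mfilterM (P : pred 'X_{1..n}) p q :
  (forall m m', P (m + m')%MM = P m && P m') ->
  mfilter P (p * q) = mfilter P p * mfilter P q.
Proof.
move=> hP; rewrite [in LHS](mpolyE q) /(mfilter P q) mulr_sumr raddf_sum mulr_sumr.
rewrite [RHS]big_mkcond; apply: eq_bigr => m _ /=.
rewrite -scalerAr; apply/mpolyP => m'.
rewrite mcoeff_filter mcoeffZ mcoeffMXE.
case Pm: (P m); rewrite -?scalerAr ?mcoeffZ ?mcoeffMXE ?mcoeff_filter ?mcoeff0.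
  case: (boolP (m <= m')%MM) => h; last by rewrite mulr0 if_same.
  by rewrite -{1}(submK h) hP Pm andbT; case: ifP; rewrite ?mulr0.
case: (boolP (m <= m')%MM) => h; last by rewrite mulr0 if_same.
by rewrite -{1}(submK h) hP Pm andbF.
Qed.

Definition avoid W : pred 'X_{1..n} := fun m => [disjoint msup m & W].

Lemma avoidD W m m' : avoid W (m + m')%MM = avoid W m && avoid W m'.
Proof.
rewrite /avoid -!setI_eq0 -setU_eq0 -setIUl; congr (_ :&: _ == _).
by apply/setP => i; rewrite !inE mnmDE addn_eq0 negb_and.
Qed.

(* The prime ideal generated by the variables indexed by W. *)
Definition var_ideal W : pred S := fun p => mfilter (avoid W) p == 0.

Lemma var_idealE W p :
  (p \in var_ideal W) = (mfilter (avoid W) p == 0). Proof. by []. Qed.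

Lemma var_idealP W p :
  reflect (forall m, avoid W m -> p@_m = 0) (p \in var_ideal W).
Proof.
rewrite var_idealE; apply: (iffP eqP) => [e m Wm|h].
  by have := mcoeff0 k m; rewrite -e mcoeff_filter Wm.
by apply/mpolyP => m; rewrite mcoeff_filter mcoeff0; case: ifP => // /h.
Qed.

Fact var_ideal_idealr_closed W : idealr_closed (var_ideal W).
Proof.
split; first by rewrite var_idealE raddf0.
  apply/var_idealP => /(_ 0%MM); rewrite mcoeff1 eqxx => h.
  suff /h /eqP : avoid W 0%MM by rewrite oner_eq0.
  rewrite /avoid -setI_eq0; apply/eqP/setP => i.
  by rewrite !inE mnm0E eqxx.
move=> a p q; rewrite !var_idealE => /eqP hp /eqP hq.
by rewrite raddfD /= mfilterM ?hp ?hq ?mulr0 ?addr0 //; apply: avoidD.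
Qed.

Fact var_ideal_prime W : prime_idealr_closed (var_ideal W).
Proof.
move=> p q; rewrite !var_idealE mfilterM; last exact: avoidD.
by rewrite mulf_eq0.
Qed.

HB.instance Definition _ W := isIdealr.Build S (var_ideal W)
  (var_ideal_idealr_closed W).
HB.instance Definition _ W := isPrimeIdealrClosed.Build S (var_ideal W)
  (@var_ideal_prime W).

Definition var_prime W : prime_idealr S := var_ideal W.

Lemma var_idealS U W : U \subset W -> {subset var_ideal U <= var_ideal W}.
Proof.
move=> UW p /var_idealP h; apply/var_idealP => m hm; apply: h.
exact: disjointWr hm.
Qed.

Lemma var_ideal_X W t : ('X_t \in var_ideal W) = (t \in W).
Proof.
have tt : msup U_(t) = [set t].
  by apply/setP => i; rewrite !inE mnm1E eqb0 negbK eq_sym.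
apply/var_idealP/idP => [h|tW m].
  apply: contraT => tW; have := h U_(t)%MM.
  rewrite /avoid tt disjoints1 tW mcoeffX eqxx => /(_ isT)/eqP.
  by rewrite oner_eq0.
rewrite mcoeffX; case: eqVneq => // <-.
by rewrite /avoid tt disjoints1 tW.
Qed.

(** The chain starts at the prime of the variables outside G and adds the variables of G one by
    one. *)
Lemma dim_ge_var (A : S -> Prop) (G : {set 'I_n}) (m : int) : m <= #|G|%:Z ->
  (forall s, A s -> s \in var_ideal (~: G)) -> dim_ge A m.
Proof.
move=> mG hA; pose V i := ~: G :|: [set j in take i (enum G)].
exists #|G|, (fun i => var_prime (V i)); split=> // [s /hA|i iG].
  by apply: var_idealS; rewrite subsetUl.
have [x0 _] : exists x0 : 'I_n, x0 \in G.
  by apply/card_gt0P; apply: leq_ltn_trans iG.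
have ie : (i < size (enum G))%N by rewrite -cardE.
split=> [|/(_ 'X_(nth x0 (enum G) i))].
  apply: var_idealS; apply: setUS; apply/subsetP => j; rewrite !inE.
  by rewrite (take_nth x0) // mem_rcons inE => ->; rewrite orbT.
rewrite !var_ideal_X !inE (take_nth x0) // mem_rcons inE eqxx orbT.
have -> : nth x0 (enum G) i \in G by rewrite -mem_enum mem_nth.
move=> /(_ isT); rewrite /= => h.
have := enum_uniq G; rewrite -{1}(cat_take_drop i (enum G)) cat_uniq.
rewrite (drop_nth x0) //= => /and3P[_ /norP[]].
by rewrite h.
Qed.

End MonomialPrimes.

(** * Upper bound for the length of a chain of primes *)

Section KrullBound.
Variables (n : nat) (k : fieldType).
Local Notation S := {mpoly k[n]}.
Implicit Types (p q : S) (m : 'X_{1..n}) (U W : {set 'I_n}).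

(** Exponent vectors as nested pairs: induction on e removes [s 0] together with the first prime of
    the chain. *)
Fixpoint expo (N e : nat) : finType :=
  if e is e'.+1 then ('I_N * expo N e')%type else unit.

Lemma card_expo N e : #|expo N e| = (N ^ e)%N.
Proof.
by elim: e => [|e IH] /=; rewrite ?card_unit // card_prod card_ord IH expnS.
Qed.

Fixpoint power_prod (s : nat -> S) N e : expo N e -> S :=
  match e with
  | 0%N => fun _ => 1
  | e'.+1 => fun x => s 0%N ^+ x.1 * @power_prod (fun i => s i.+1) N e' x.2
  end.

Lemma scale_mem (I : prime_idealr S) (c : k) p :
  p \in (I : {pred S}) -> c *: p \in (I : {pred S}).
Proof. by move=> h; rewrite -mul_mpolyC idealMr. Qed.

(* If s_i lies in P_(i+1) but not in P_i, the lexicographically least monomial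
   of a relation among the s_i modulo P_0 would have to have coefficient 0. *)
Lemma power_prod_free N e (P : nat -> prime_idealr S) (s : nat -> S) :
  (forall i, (i < e)%N -> {subset (P i : {pred S}) <= (P i.+1 : {pred S})}) ->
  (forall i, (i < e)%N -> s i \in (P i.+1 : {pred S})) ->
  (forall i, (i < e)%N -> s i \notin (P i : {pred S})) ->
  forall f : expo N e -> k,
  \sum_x f x *: @power_prod s N e x \in (P 0%N : {pred S}) -> forall x, f x = 0.
Proof.
elim: e P s => [|e IH] P s hP hs hs' f.
  rewrite (bigD1 tt) //= big1 ?addr0 => [h []|[] //].
  have [//|nz] := eqVneq (f tt) 0.
  have := @scale_mem _ (f tt)^-1 _ h.
  by rewrite scalerA mulVf // scale1r idealr1.
move=> hf.
pose g (a : 'I_N) : S := \sum_y f (a, y) *: @power_prod (fun i => s i.+1) N e y.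
have eg : \sum_x f x *: @power_prod s N e.+1 x = \sum_(a < N) s 0%N ^+ a * g a.
  transitivity (\sum_(a < N) \sum_(y : expo N e) f (a, y) *:
     (s 0%N ^+ a * @power_prod (fun i => s i.+1) N e y)).
    by rewrite pair_bigA; apply: eq_bigr => -[].
  apply: eq_bigr => a _; rewrite mulr_sumr; apply: eq_bigr => y _.
  by rewrite -scalerAr.
rewrite {}eg in hf.
suff key : forall b (a : 'I_N), (a < b)%N -> forall y, f (a, y) = 0.
  by case=> a y; apply: (key N).
elim=> // b IHb a; rewrite ltnS leq_eqVlt => /orP[/eqP ab|]; last exact: IHb.
apply: (IH (fun i => P i.+1) (fun i => s i.+1)) => [i ie|i ie|i ie|].
- exact: hP.
- exact: hs.
- exact: hs'.
have g0 (c : 'I_N) : (c < a)%N -> g c = 0.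
  rewrite ab => cb; rewrite /g big1 // => y _.
  by rewrite (IHb c cb) scale0r.
(* The power [s 0 ^+ a] is outside the prime [P 0], so the other factor is in [P 0], hence in [P 1].
   As [s 0] is in [P 1], so is [g a], which is a relation for the shorter chain. *)
have e1 : \sum_(c < N) s 0%N ^+ c * g c =
    s 0%N ^+ a * (g a + s 0%N * \sum_(c < N | (a < c)%N) s 0%N ^+ (c - a.+1) * g c).
  rewrite (bigID (fun c : 'I_N => (a < c)%N)) /= addrC (bigD1 a) ?ltnn //=.
  rewrite big1 ?addr0 => [|c /andP[]]; last first.
    rewrite -leqNgt => ca nca; rewrite g0 ?mulr0 //.
    by rewrite ltn_neqAle ca andbT.
  rewrite mulrDr; congr (_ + _); rewrite !mulr_sumr; apply: eq_bigr => c ac.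
  by rewrite !mulrA -exprSr -exprD subnKC.
have spow j : s 0%N ^+ j \notin (P 0%N : {pred S}).
  elim: j => [|j IHj]; first by rewrite expr0 idealr1.
  by rewrite exprS prime_idealrM negb_or hs'.
move: hf; rewrite e1 prime_idealrM (negPf (spow a)) /=.
set h := \sum_(c < N | _) _ => /(hP 0%N isT) hh.
have -> : \sum_y f (a, y) *: @power_prod (fun i => s i.+1) N e y = g a by [].
rewrite -[g a](addrK (s 0%N * h)) rpredB // mulrC idealMr //.
exact: hs.
Qed.

Definition deg_le d p := forall m, p@_m != 0 -> (mdeg m <= d)%N.

Lemma deg_leM d e p q : deg_le d p -> deg_le e q -> deg_le (d + e) (p * q).
Proof.
move=> hp hq m; rewrite -mcoeff_msupp => /msuppM_le /allpairsP[[m1 m2] /= [h1 h2 ->]].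
by rewrite mdegD leq_add ?hp ?hq // -mcoeff_msupp.
Qed.

Lemma deg_leW d e p : (d <= e)%N -> deg_le d p -> deg_le e p.
Proof. by move=> de h m /h /leq_trans; apply. Qed.

Lemma deg_le1 : deg_le 0 1.
Proof.
move=> m; rewrite mcoeff1; case: (eqVneq m 0%MM) => [->|_]; last by rewrite eqxx.
by rewrite mdeg0.
Qed.

Lemma deg_leX d p j : deg_le d p -> deg_le (j * d) (p ^+ j).
Proof.
move=> h; elim: j => [|j IH]; first exact: deg_le1.
by rewrite exprS mulSn; apply: deg_leM.
Qed.

Lemma power_prod_deg D N e s : (forall i, (i < e)%N -> deg_le D (s i)) ->
  forall x, deg_le (e * (N * D)) (@power_prod s N e x).
Proof.
elim: e s => [|e IH] s hs x; first exact: deg_le1.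
rewrite mulSn; apply: deg_leM.
  apply: (@deg_leW (x.1 * D)); last by apply: deg_leX; apply: hs.
  by rewrite leq_mul2r ltnW ?orbT.
by apply: IH => i ie; apply: hs.
Qed.

Lemma deg_le_exists (s : nat -> S) e :
  exists D, forall i, (i < e)%N -> deg_le D (s i).
Proof.
exists (\max_(i < e) msize (s i)) => i ie m; rewrite -mcoeff_msupp => hm.
apply: leq_trans (leq_bigmax (Ordinal ie)) => /=.
exact: ltnW (msize_mdeg_lt hm).
Qed.

Lemma filter_mem (I : prime_idealr S) U p :
  (forall t, t \notin U -> 'X_t \in (I : {pred S})) ->
  p - mfilter (avoid (~: U)) p \in (I : {pred S}).
Proof.
move=> hI; rewrite {1}(mpolyE p) /mfilter [X in X - _](bigID (avoid (~: U))) /=.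
rewrite addrAC subrr add0r; apply: rpred_sum => m; rewrite /avoid -setI_eq0.
case/set0Pn => t; rewrite !inE => /andP[mt tU].
apply: scale_mem; rewrite -(@submK _ U_(t) m) ?lep1mP // mpolyXD.
by rewrite idealMr // hI.
Qed.

(* More elements than there are monomials are linearly dependent. *)
Lemma chain_length_le U e (P : nat -> prime_idealr S) :
  (forall t, t \notin U -> 'X_t \in (P 0%N : {pred S})) ->
  (forall i, (i < e)%N -> {subset (P i : {pred S}) <= (P i.+1 : {pred S})} /\
      ~ {subset (P i.+1 : {pred S}) <= (P i : {pred S})}) ->
  (e <= #|U|)%N.
Proof.
move=> hU hP; rewrite leqNgt; apply/negP => Ue.
have hs i : exists s : S, (i < e)%N ->
    s \in (P i.+1 : {pred S}) /\ s \notin (P i : {pred S}).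
  case: (ltnP i e) => ie; last by exists 0.
  have [_ h] := hP i ie; apply: contrapT => h'; apply: h => s hs.
  by apply: contrapT => /negP hs'; apply: h'; exists s.
pose s i := sval (cid (hs i)); have sP i := svalP (cid (hs i)).
set c := #|U| in Ue; pose e' := c.+1.
have [D hD] := deg_le_exists s e'.
(* Products with exponents below N have degree at most L, and L + 1 <= K N, so at most (K N)^c
   monomials in the variables of U occur, against N^(c+1) products. The choice N > K^c makes the
   latter number larger. *)
pose K := (e' * D).+1; pose N := (K ^ c).+1; pose L := (e' * (N * D))%N.
pose J := pffun_on (ord0 : 'I_L.+1) (mem U) predT.
have cJ : #|J| = (L.+1 ^ c)%N by rewrite card_pffun_on card_ord.
have lt : (#|J| < #|expo N e'|)%N.
  rewrite cJ card_expo; apply: (@leq_ltn_trans ((K * N) ^ c)).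
    have [->|c0] := posnP c; first by rewrite !expn0.
    by rewrite leq_exp2r // /L mulnCA /K mulSn [(e' * D * N)%N]mulnC -add1n leq_add.
  by rewrite expnMn expnS ltn_pmul2r ?expn_gt0.
pose mon (j : {ffun 'I_n -> 'I_L.+1}) : 'X_{1..n} := [multinom (j i : nat) | i < n].
pose A : 'M[k]_(#|expo N e'|, #|J|) :=
  \matrix_(x, j) (@power_prod s N e' (enum_val x))@_(mon (enum_val j)).
have : kermx A != 0.
  rewrite kermx_eq0 /row_free neq_ltn; apply/orP; left.
  exact: leq_ltn_trans (rank_leq_col A) lt.
case/rowV0Pn => v /sub_kermxP vA /negP; apply; apply/eqP.
pose f (x : expo N e') := v 0 (enum_rank x).
have f0 : forall x, f x = 0.
  apply: (@power_prod_free N e' P s) => [i ie|i ie|i ie|].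
  - by have [] := hP i (leq_trans ie Ue).
  - by have [] := sP i (leq_trans ie Ue).
  - by have [] := sP i (leq_trans ie Ue).
  (* By the choice of v, no monomial in the variables of U alone survives in Q; all others involve a
     variable of [P 0]. *)
  set Q := \sum_x _; rewrite -[Q]subr0.
  rewrite -(_ : mfilter (avoid (~: U)) Q = 0); first exact: filter_mem.
  apply/mpolyP => m; rewrite mcoeff_filter mcoeff0; case: ifP => // mU.
  rewrite raddf_sum /=.
  have [dm|dm] := leqP (mdeg m) L; last first.
    rewrite big1 // => x _; rewrite mcoeffZ.
    have [->|/(power_prod_deg hD)] := eqVneq (@power_prod s N e' x)@_m 0.
      by rewrite mulr0.
    by rewrite leqNgt dm.
  have mi i : (m i < L.+1)%N.
    by rewrite ltnS (leq_trans _ dm) // mdegE (bigD1 i) //= leq_addr.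
  pose j : {ffun 'I_n -> 'I_L.+1} := [ffun i => Ordinal (mi i)].
  have jm : mon j = m by apply/mnmP => i; rewrite mnmE ffunE.
  have jJ : j \in J.
    apply/pffun_onP; split=> //; apply/subsetP => i; rewrite inE ffunE => h.
    have : i \in msup m by rewrite inE.
    apply: contraTT => iU; move: mU; rewrite /avoid disjoint_sym.
    by move=> /disjointFr->//; rewrite inE.
  transitivity ((v *m A) 0 (enum_rank_in jJ j)); last by rewrite vA mxE.
  rewrite mxE [RHS](reindex (@enum_rank (expo N e'))) /=; last first.
    exact/onW_bij/enum_rank_bij.
  by apply: eq_bigr => x _; rewrite mcoeffZ mxE enum_rankK enum_rankK_in // jm.
by apply/rowP => i; rewrite mxE -(enum_valK i); apply: f0.
Qed.

Lemma dim_ge_bound (A : S -> Prop) (m : int) :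
  (forall U, m <= #|U|%:Z -> A 'X_[setm U]) -> ~ dim_ge A m.
Proof.
move=> hA [e [P [me hP0 hP]]].
pose U := [set t | 'X_t \notin (P 0%N : {pred S})].
have xU : 'X_[setm U] \notin (P 0%N : {pred S}).
  rewrite -sqfree_monomialE /sqfree_monomial.
  elim/big_rec: _ => [|t p tU IH]; first by rewrite idealr1.
  by rewrite prime_idealrM negb_or IH andbT; move: tU; rewrite inE.
have mU : #|U|%:Z < m.
  by rewrite ltNge; apply: contra xU => h; apply: hP0; apply: hA.
have := lt_le_trans mU me; rewrite ltz_nat ltnNge => /negP; apply.
by apply: chain_length_le hP => t; rewrite inE negbK.
Qed.

End KrullBound.

(** * Multigraded pieces of Ext *)

Section Coboundary.
Variables (n : nat) (R : comNzRingType) (x : 'I_n -> R).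
Variable Delta : {set {set 'I_n}}.
Hypothesis Delta_closed : forall F G : {set 'I_n},
  F \in Delta -> G \subset F -> G \in Delta.
Implicit Types (F T : {set 'I_n}) (f g : {set 'I_n} -> {set 'I_n} -> R).

Lemma cobd_eq f g : f =2 g -> cobd x f =2 cobd x g.
Proof.
move=> e F T; rewrite /cobd; case: ifP => // _; apply: eq_bigr => t _.
by rewrite !e.
Qed.

Lemma cobd_sum (I : eqType) (r : seq I) (f : I -> {set 'I_n} -> {set 'I_n} -> R) F T :
  cobd x (fun F T => \sum_(i <- r) f i F T) F T = \sum_(i <- r) cobd x (f i) F T.
Proof.
rewrite /cobd; case: ifP => // _; last by rewrite big1.
rewrite exchange_big /=; apply: eq_bigr => t _.
by rewrite -mulr_sumr sumrB -mulr_sumr.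
Qed.

Lemma cobdZ a f F T : cobd x (fun F T => a * f F T) F T = a * cobd x f F T.
Proof.
rewrite /cobd; case: ifP => // _; last by rewrite mulr0.
rewrite mulr_sumr; apply: eq_bigr => t _.
by rewrite [x t * _]mulrCA -mulrBr mulrCA.
Qed.

Lemma cobdN f F T : cobd x (fun F T => - f F T) F T = - cobd x f F T.
Proof.
by rewrite -[RHS]mulN1r -cobdZ; apply: cobd_eq => F' T'; rewrite mulN1r.
Qed.

Lemma cobdB f g F T :
  cobd x (fun F T => f F T - g F T) F T = cobd x f F T - cobd x g F T.
Proof.
rewrite /cobd; case: ifP => // _; last by rewrite subr0.
rewrite -sumrB; apply: eq_bigr => t _.
by rewrite -[RHS]mulrBr [x t * _]mulrBr; congr (_ * _); rewrite !opprD !opprK addrACA.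
Qed.

Lemma cobd_chain i f : chain Delta i f -> chain Delta i.+1 (cobd x f).
Proof.
move=> hf F T; rewrite /cobd; case: ifP => dj; last by rewrite eqxx.
move=> nz; have /existsP[t /andP[tT]] :
    [exists t, (t \in T) && (x t * f F (T :\ t) - f (t |: F) (T :\ t) != 0)].
  apply: contraNT nz; rewrite negb_exists => /forallP h.
  apply/eqP/big1 => t tT; move: (h t); rewrite tT negbK => /eqP ->.
  by rewrite mulr0.
have [->|/hf[FD _ e _]] := eqVneq (f F (T :\ t)) 0; last first.
  by split=> //; rewrite (cardsD1 t) tT e.
rewrite mulr0 sub0r oppr_eq0 => /hf[FD _ e]; split=> //.
  by apply: Delta_closed FD _; rewrite subsetUr.
by rewrite (cardsD1 t) tT e.
Qed.

(* Cochains of degree i - 1; there are none for i = 0. *)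
Definition prechain i f := forall F T, f F T != 0 ->
  [/\ F \in Delta, [disjoint F & T] & #|T|.+1 = i].

Lemma prechainS i f : prechain i.+1 f <-> chain Delta i f.
Proof.
by split=> h F T /h[h1 h2] => [[<-]|<-].
Qed.

Lemma prechain0 f : prechain 0 f -> forall F T, f F T = 0.
Proof. by move=> h F T; apply/eqP; apply: contraT => /h[]. Qed.

Lemma cobd_prechain i f : prechain i f -> chain Delta i (cobd x f).
Proof.
case: i => [/prechain0 h|i /prechainS]; last exact: cobd_chain.
move=> F T; rewrite /cobd; case: ifP => _; last by rewrite eqxx.
by rewrite big1 ?eqxx // => t _; rewrite !h mulr0 subr0 mulr0.
Qed.

End Coboundary.

(** * The annihilator of Ext in terms of its strands *)

Section ExtStrands.
Variables (n : nat) (k : fieldType) (Delta : {set {set 'I_n}}).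
Hypothesis Delta_closed : forall F G : {set 'I_n},
  F \in Delta -> G \subset F -> G \in Delta.
Hypothesis Delta0 : set0 \in Delta.
Local Notation S := {mpoly k[n]}.
Local Notation X := (fun t : 'I_n => 'X_t : S).
Local Notation cobd1 := (@cobd n k (fun _ => 1)).
Local Notation P := (SR_resolution k Delta_closed Delta0).
Implicit Types (F T G U : {set 'I_n}) (b m : 'X_{1..n}).
Implicit Types (f g : {set 'I_n} -> {set 'I_n} -> S).
Implicit Types (l : {set 'I_n} -> {set 'I_n} -> k).

Lemma ext_cocycleP i f : chain Delta i f ->
  @ext_cocycle _ _ P i (cvec Delta i f) <-> forall F T, cobd X f F T = 0.
Proof.
move=> hf; rewrite /ext_cocycle /= cvec_cobd //.
have c0 : chain Delta i.+1 (fun _ _ => 0 : S) by move=> ? ?; rewrite eqxx.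
have <- : cvec Delta i.+1 (fun _ _ => 0 : S) = 0 by apply/colP => p; rewrite !mxE.
by rewrite cvecP //; apply: cobd_chain.
Qed.

Lemma ext_coboundaryP i f : chain Delta i f ->
  @ext_coboundary _ _ P i (cvec Delta i f) <->
  exists2 g, prechain Delta i g & f =2 cobd X g.
Proof.
case: i => [|i] hf /=.
  have c0 : chain Delta 0 (fun _ _ => 0 : S) by move=> ? ?; rewrite eqxx.
  have <- : cvec Delta 0 (fun _ _ => 0 : S) = 0 by apply/colP => p; rewrite !mxE.
  rewrite cvecP //; split=> [e|[g /prechain0 h e] F T].
    exists (fun _ _ => 0) => [? ?|F T]; first by rewrite eqxx.
    rewrite e /cobd; case: ifP => // _.
    by rewrite big1 // => t _; rewrite mulr0 subr0 mulr0.
  rewrite e /cobd; case: ifP => // _; rewrite big1 // => t _.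
  by rewrite !h mulr0 subr0 mulr0.
split=> [[w]|[g /prechainS hg e]]; last first.
  exists (cvec Delta i g); rewrite cvec_cobd //; apply/cvecP => //.
  exact: cobd_chain.
have [g hg ->] := cvec_surj w; rewrite cvec_cobd // => e.
exists g; first exact/prechainS.
by apply/(cvecP hf) => //; apply: cobd_chain.
Qed.

(* A cochain with values in S splits into its multigraded pieces.  The piece
   with index b has the exponent b - (complement of F :|: T) at (F, T), hence it
   only depends on the support of b: all the x_t act as 1 on the coefficients. *)
Definition strand_of b f F T : k :=
  if ~: (F :|: T) \subset msup b then (f F T)@_(b - setm (~: (F :|: T))) else 0.

Definition of_strand b l F T : S := l F T *: 'X_[b - setm (~: (F :|: T))].

Definition supported G l := forall F T, l F T != 0 -> ~: (F :|: T) \subset G.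

Lemma strand_of_supported b f : supported (msup b) (strand_of b f).
Proof. by move=> F T; rewrite /strand_of; case: ifP => // _; rewrite eqxx. Qed.

Lemma strand_of_neq0 b f F T : strand_of b f F T != 0 -> f F T != 0.
Proof.
rewrite /strand_of; case: ifP => _; last by rewrite eqxx.
by apply: contraNneq => ->; rewrite mcoeff0.
Qed.

Lemma of_strand_neq0 b l F T : of_strand b l F T != 0 -> l F T != 0.
Proof. by apply: contraNneq => e; rewrite /of_strand e scale0r. Qed.

Lemma mcoeff_sgn t T (p : S) m : (sgn S t T * p)@_m = sgn k t T * p@_m.
Proof.
rewrite /sgn -signr_odd mulr_sign -[in RHS]signr_odd mulr_sign.
by case: odd => //; rewrite mcoeffN.
Qed.

Lemma setCU_D1 F T t : t \in T -> [disjoint F & T] ->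
  ~: (F :|: T :\ t) = t |: ~: (F :|: T).
Proof.
move=> tT dj; apply/setP => i; rewrite !inE.
by case: eqVneq => [->|_] //=; rewrite orbF (disjointFl dj tT).
Qed.

Lemma setUC_D1 F T t : t \in T -> (t |: F) :|: T :\ t = F :|: T.
Proof. by move=> tT; rewrite setUAC setD1K // setUC. Qed.

(** Removing t from T adds t to the complement of the union and lowers the exponent by one in t,
    which the factor x_t makes up for; moving t into F leaves the union unchanged. *)
Lemma strand_of_cobd b f F T :
  strand_of b (cobd X f) F T = cobd1 (strand_of b f) F T.
Proof.
rewrite {1}/strand_of /cobd.
case: (boolP [disjoint F & T]) => dj; last by rewrite mcoeff0 if_same.
set c := ~: (F :|: T); case: ifPn => cb; last first.
  rewrite big1 // => t tT; rewrite /strand_of setUC_D1 // (negPf cb).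
  rewrite setCU_D1 // subUset (negPf cb) andbF.
  by rewrite mulr0 subr0 mulr0.
rewrite raddf_sum /=; apply: eq_bigr => t tT; rewrite mcoeff_sgn; congr (_ * _).
have tc : t \notin c by rewrite !inE tT orbT.
rewrite mcoeffB mul1r /strand_of setUC_D1 // cb; congr (_ - _).
rewrite mcoeffXM setCU_D1 // subUset sub1set cb andbT inE mnmBE setmE (negPf tc) subn0.
by case: ifP => // _; rewrite setmU1 // submDA addmC.
Qed.

(** The support condition is there because subtraction of exponents is truncated. *)
Lemma of_strand_cobd b l F T : supported (msup b) l ->
  of_strand b (cobd1 l) F T = cobd X (of_strand b l) F T.
Proof.
move=> hl; rewrite {1}/of_strand /cobd; case: ifP => dj; last by rewrite scale0r.
set c := ~: (F :|: T).
rewrite scaler_suml; apply: eq_bigr => t tT.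
have tc : t \notin c by rewrite !inE tT orbT.
rewrite /of_strand setUC_D1 // -/c -scalerAr -[sgn S t T * _]/(_).
have -> : forall p : S, sgn S t T * p = sgn k t T *: p.
  move=> p; apply/mpolyP => m; by rewrite mcoeff_sgn mcoeffZ.
rewrite -scalerA; congr (_ *: _); rewrite mul1r scalerBl; congr (_ - _).
have [->|nz] := eqVneq (l F (T :\ t)) 0; first by rewrite !scale0r.
congr (_ *: _); rewrite setCU_D1 // -/c -mpolyXD setmU1 //; congr 'X_[_].
have := hl _ _ nz; rewrite setCU_D1 // -/c subUset sub1set inE => /andP[tb _].
apply/mnmP => i; rewrite mnmDE !mnmBE mnmDE mnm1E setmE.
case: eqVneq => [<-|_] /=; last by rewrite !add0n.
by rewrite (negPf tc) addn0 subn0 subnKC // lt0n.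
Qed.

Definition ext_nontrivial i G := exists l,
  [/\ chain Delta i l, supported G l, forall F T, cobd1 l F T = 0 &
      ~ exists u, [/\ prechain Delta i u, supported G u & l =2 cobd1 u]].

(** Let l be placed at the index [setm G], and let m be a monomial in the variables of G. The piece
    of the product with s at the index [m + setm G], still of support G, is [s@_m] times l. If s
    kills the class, that piece is a coboundary, so [s@_m] must be 0. *)
Lemma ext_ann_nontrivial i G s :
  ext_nontrivial i G -> @ext_ann _ _ P i s -> s \in var_ideal (~: G).
Proof.
case=> l [hl sl cl nb] hs; apply/var_idealP => m; rewrite /avoid.
rewrite -subsets_disjoint => mG.
have mG0 : msup (setm G) = G.
  by apply/setP => i'; rewrite inE setmE; case: (i' \in G).
have mbG : msup (m + setm G) = G.
  apply/setP => j; rewrite inE mnmDE setmE addn_eq0 negb_and.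
  case jG: (j \in G); first by rewrite orbT.
  rewrite orbF; apply/negbTE; apply: contraFN jG => h.
  by apply: (subsetP mG); rewrite inE.
pose f := of_strand (setm G) l.
have hf : chain Delta i f by move=> F T /of_strand_neq0/hl.
have cf F T : cobd X f F T = 0.
  rewrite -of_strand_cobd; last by rewrite mG0.
  by rewrite /of_strand cl scale0r.
have hsf : chain Delta i (fun F T => s * f F T).
  move=> F T nz; apply: hf; apply: contraNneq nz => ->; by rewrite mulr0.
have := hs _ ((ext_cocycleP hf).2 cf).
have -> : s *: cvec Delta i f = cvec Delta i (fun F T => s * f F T).
  by apply/colP => p; rewrite !mxE.
rewrite ext_coboundaryP // => -[w hw ew].
have [//|sm] := eqVneq s@_m 0; case: nb.
exists (fun F T => (s@_m)^-1 * strand_of (m + setm G) w F T); split.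
- move=> F T; rewrite mulf_eq0 negb_or => /andP[_ /strand_of_neq0 /hw].
  by [].
- move=> F T; rewrite mulf_eq0 negb_or => /andP[_ /strand_of_supported].
  by rewrite mbG.
move=> F T; rewrite cobdZ -strand_of_cobd.
have -> : strand_of (m + setm G) (cobd X w) F T =
    strand_of (m + setm G) (fun F T => s * f F T) F T.
  by rewrite /strand_of ew.
rewrite /strand_of mbG.
have [l0|lnz] := eqVneq (l F T) 0.
  by rewrite /f /of_strand l0 scale0r mulr0 mcoeff0 if_same mulr0.
have cG := sl _ _ lnz; rewrite cG /f /of_strand -scalerAr mcoeffZ.
have -> : (m + setm G - setm (~: (F :|: T)))%MM =
    (setm G - setm (~: (F :|: T)) + m)%MM.
  by rewrite -addmBA ?setm_le ?mG0 // addmC.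
by rewrite mcoeffMX mulrCA mulVf // mulr1.
Qed.

(** Multiplication by the monomial of U carries the piece at b to the index [b + setm U], whose
    support contains U; there every cocycle has a primitive. The primitives of the finitely many
    pieces are added up. *)
Lemma ext_ann_monomial i (d : int) :
  (forall G, d <= #|G|%:Z -> ~ ext_nontrivial i G) ->
  forall U, d <= #|U|%:Z -> @ext_ann _ _ P i 'X_[setm U].
Proof.
move=> hG U dU v; have [f hf ->] := cvec_surj v.
move=> /(ext_cocycleP hf) cf.
have hmu b : exists u, [/\ prechain Delta i u, supported (msup b :|: U) u &
    strand_of b f =2 cobd1 u].
  apply: contrapT => nu; apply: (hG (msup b :|: U)).
    by apply: le_trans dU _; rewrite lez_nat subset_leq_card // subsetUr.
  exists (strand_of b f); split=> //.
  - by move=> F T /strand_of_neq0/hf.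
  - by move=> F T /strand_of_supported h; apply: subset_trans h _; rewrite subsetUl.
  - by move=> F T; rewrite -strand_of_cobd /strand_of cf mcoeff0 if_same.
pose mu b := sval (cid (hmu b)); have muP b := svalP (cid (hmu b)).
(* A finite list of indices containing all those with a nonzero piece of f. *)
pose B := undup (flatten [seq [seq (m + setm (~: (c.1 :|: c.2)))%MM
  | m <- msupp (f c.1 c.2)] | c <- enum [set: {set 'I_n} * {set 'I_n}]]).
have memB b F T : strand_of b f F T != 0 -> b \in B.
  rewrite /strand_of; case: ifP => [cb|]; last by rewrite eqxx.
  move=> nz; rewrite mem_undup; apply/flattenP; eexists.
    by apply: map_f; rewrite mem_enum; apply: (in_setT (F, T)).
  apply/mapP; exists (b - setm (~: (F :|: T)))%MM; first by rewrite mcoeff_msupp.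
  by rewrite submK // setm_le.
have sU b : msup (b + setm U) = msup b :|: U.
  apply/setP => j; rewrite !inE mnmDE setmE addn_eq0 negb_and.
  by case: (j \in U).
pose w F T := \sum_(b <- B) of_strand (b + setm U) (mu b) F T.
have hw : prechain Delta i w.
  move=> F T nz; have : has (fun b => mu b F T != 0) B.
    apply: contraNT nz => /hasPn h; rewrite /w big_seq big1 // => b /h.
    by rewrite negbK /of_strand => /eqP ->; rewrite scale0r.
  by case/hasP => b _; have [h _ _] := muP b; apply: h.
have hUf : chain Delta i (fun F T => 'X_[setm U] * f F T).
  move=> F T nz; apply: hf; apply: contraNneq nz => ->; by rewrite mulr0.
have -> : 'X_[setm U] *: cvec Delta i f = cvec Delta i (fun F T => 'X_[setm U] * f F T).
  by apply/colP => p; rewrite !mxE.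
apply/ext_coboundaryP => //; exists w => // F T.
rewrite /w cobd_sum.
rewrite (eq_bigr (fun b => strand_of b f F T *:
    'X_[b + setm U - setm (~: (F :|: T))])); last first.
  move=> b _; have [_ s e] := muP b.
  by rewrite -of_strand_cobd ?sU // /of_strand -e.
set c := ~: (F :|: T); apply/mpolyP => m; rewrite mcoeff_sumX mulrC mcoeffMXE.
have eb b : strand_of b f F T != 0 ->
    (b + setm U - setm c)%MM = (setm U + (b - setm c))%MM.
  move=> /strand_of_supported h; rewrite addmC addmBA // setm_le //.
case: ifPn => Um; last first.
  rewrite big1 // => b _; have [->|nz] := eqVneq (strand_of b f F T) 0.
    by rewrite mul0rn.
  rewrite eb //; case: eqVneq => // e; move: Um; rewrite -e lem_addr //.
(* The only index whose shifted piece can contribute to the monomial m at [(F, T)]. *)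
pose b0 := (m - setm U + setm c)%MM.
have cb0 : c \subset msup b0 by rewrite -setm_le lem_addl.
have eb0 : strand_of b0 f F T = (f F T)@_(m - setm U).
  by rewrite /strand_of -/c cb0 addmK.
rewrite (eq_bigr (fun b => strand_of b0 f F T *+ (b == b0))); last first.
  move=> b _; case: (eqVneq b b0) => [->|bb0].
    have [->|nz] := eqVneq (strand_of b0 f F T) 0; first by rewrite !mul0rn.
    by rewrite eb // addmK addmC submK // eqxx.
  have [->|nz] := eqVneq (strand_of b f F T) 0; first by rewrite mul0rn.
  rewrite eb //; case: eqVneq => // e; case/eqP: bb0.
  rewrite /b0 -e [(setm U + _)%MM]addmC addmK submK // setm_le; exact: strand_of_supported nz.
rewrite -eb0; have [b0B|b0B] := boolP (b0 \in B); last first.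
  have -> : strand_of b0 f F T = 0.
    by apply/eqP; apply: contraNT b0B; apply: memB.
  by rewrite big1 // => b _; rewrite mul0rn.
rewrite (bigD1_seq b0) ?undup_uniq //= eqxx big1 ?addr0 // => b /negPf ->.
by rewrite mulr0n.
Qed.

End ExtStrands.

(** * Homology of links *)

Section LinkHomology.
Variables (n : nat) (k : fieldType) (Delta : {set {set 'I_n}}).
Hypothesis Delta_closed : forall F G : {set 'I_n},
  F \in Delta -> G \subset F -> G \in Delta.
Local Notation sg := (sgn k).
Local Notation cobd1 := (@cobd n k (fun _ => 1)).
Implicit Types (s t u v : 'I_n) (F T G A : {set 'I_n}).
Implicit Types (l w : {set 'I_n} -> {set 'I_n} -> k) (a c : {set 'I_n} -> k).

Definition sbd a T : k := \sum_(t | t \notin T) sg t T * a (t |: T).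

Definition link_chain G q a := forall T, a T != 0 ->
  [/\ [disjoint T & G], T :|: G \in Delta & #|T| = q].

(** Nonvanishing reduced homology of the link in dimension q - 1; the empty face counts as a chain
    of cardinality 0. *)
Definition link_nontrivial G q := exists a,
  [/\ link_chain G q a, forall T, sbd a T = 0 &
      ~ exists2 c, link_chain G q.+1 c & a =1 sbd c].

Lemma sgn_antiD s t T : s != t -> s \in T -> t \in T ->
  sg s T * sg t (T :\ s) = - (sg t T * sg s (T :\ t)).
Proof.
move=> st sT tT; pose T0 := T :\ s :\ t.
have eS : T :\ s = t |: T0 by rewrite /T0 setD1K // !inE tT eq_sym st.
have eT : T :\ t = s |: T0.
  by rewrite /T0 setDDl [[set s; t]]setUC -setDDl setD1K // !inE sT st.
have s0 : s \notin T0 by rewrite !inE eqxx andbF.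
have t0 : t \notin T0 by rewrite !inE eqxx.
rewrite -[sg s T]sgnDself -[sg t T]sgnDself eS eT !sgnUself.
by rewrite mulrC sgn_anti 1?eq_sym // [in RHS]mulrC.
Qed.

Lemma cobd_cobd l F T : cobd1 (cobd1 l) F T = 0.
Proof.
rewrite {1}/cobd; case: ifP => // dj.
pose X s t := l F (T :\ s :\ t) - l (t |: F) (T :\ s :\ t)
  - (l (s |: F) (T :\ s :\ t) - l (t |: (s |: F)) (T :\ s :\ t)).
pose b s t := if (s \in T) && (t \in T) then sg s T * sg t (T :\ s) * X s t else 0.
rewrite -[RHS](@alternating_sum0 n _ b).
  rewrite big_mkcond; apply: eq_bigr => s _; rewrite /b.
  case: ifP => sT /=; last by rewrite big1.
  have dj1 : [disjoint F & T :\ s] by apply: disjointWr dj; rewrite subsetDl.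
  have dj2 : [disjoint s |: F & T :\ s].
    by rewrite disjoints_subset subUset sub1set !inE eqxx -disjoints_subset.
  rewrite mul1r /cobd dj1 dj2 -sumrB mulr_sumr.
  rewrite [RHS]big_mkcond [LHS]big_mkcond; apply: eq_bigr => t _.
  rewrite in_setD1; case: eqVneq => //= _; case: ifP => // tT.
  by rewrite !mul1r -mulrBr mulrA.
move=> s t st; rewrite /b [(t \in T) && _]andbC; case: ifP => [/andP[sT tT]|].
  rewrite sgn_antiD // mulNr; congr (- (_ * _)); rewrite /X.
  rewrite setUCA !setDDl [[set s; t]]setUC.
  rewrite !opprB !addrA addrAC [RHS]addrAC; congr (_ + _).
  by rewrite -!addrA; congr (_ + _); rewrite addrC.
by rewrite oppr0.
Qed.

(** A homotopy available because x_u acts as 1: subtracting [d kap_u + kap_u d] from the identity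
    kills the components with u in T and reads the others at [u |: F]. *)
Definition kap u l F T : k :=
  if (u \notin F) && (u \notin T) then sg u T * l F (u |: T) else 0.

Lemma cobd_kap u l F T : [disjoint F & T] ->
  cobd1 (kap u l) F T + kap u (cobd1 l) F T =
  if u \in T then l F T else if u \in F then 0 else l F T - l (u |: F) T.
Proof.
move=> dj; case: ifPn => uT.
  rewrite [X in _ + X]/kap uT andbF addr0 /cobd dj (bigD1 u) //= big1.
    rewrite addr0 mul1r /kap (disjointFl dj uT) !inE eqxx /= subr0.
    by rewrite setD1K // sgnDself mulrA sgnK mul1r.
  move=> t /andP[tT tu]; rewrite /kap !inE uT [u == t]eq_sym tu /= !andbF.
  by rewrite mulr0 subr0 mulr0.
case: ifPn => uF.
  rewrite [X in _ + X]/kap uF addr0 /cobd dj big1 // => t tT.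
  by rewrite /kap !inE uF orbT /= mulr0 subr0 mulr0.
rewrite [X in _ + X]/kap uF uT /= {2}/cobd.
have dj' : [disjoint F & u |: T].
  by rewrite disjoint_sym disjoints_subset subUset sub1set inE uF
    -disjoints_subset disjoint_sym.
rewrite dj' (big_setU1 _ uT) /= mulrDr !mul1r setU1K // sgnUself !mulrA sgnK mul1r.
rewrite addrCA -[RHS]addr0; congr (_ + _).
rewrite /cobd dj mulr_sumr -big_split big1 //= => t tT.
have ut : u != t by apply: contraNneq uT => ->.
rewrite /kap !inE (negPf uF) (negPf uT) (negPf ut) /=.
have -> : (u |: T) :\ t = u |: T :\ t.
  rewrite setDUl; congr (_ :|: _); apply/setP => j; rewrite !inE.
  by case: (eqVneq j u) => [->|]; rewrite ?ut ?andbF.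
rewrite !mul1r -mulrBr !mulrA -mulrDl.
have tT' : t \notin T :\ t by rewrite !inE eqxx.
have uT' : u \notin T :\ t by rewrite !inE (negPf uT) andbF.
rewrite -{1 3 4}(setD1K tT) !sgnUself setUCA sgnUself.
by rewrite [sg u _ * _]mulrC sgn_swap 1?eq_sym // addrN mul0r.
Qed.

Lemma cobd_supported G l : supported G l -> supported G (cobd1 l).
Proof.
move=> hl F T; apply: contraR => nG; rewrite /cobd; case: ifP => // dj.
apply/eqP/big1 => t tT.
have z F' T' : F' :|: T' \subset F :|: T -> l F' T' = 0.
  move=> h; apply/eqP; apply: contraNT nG => /hl; apply: subset_trans.
  by rewrite setCS.
rewrite !z ?mulr0 ?subr0 ?mulr0 //.
  by rewrite setUC_D1.
by apply: setUS; rewrite subsetDl.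
Qed.

Lemma supportedB G l w : supported G l -> supported G w ->
  supported G (fun F T => l F T - w F T).
Proof.
move=> hl hw F T; have [e|/hl //] := eqVneq (l F T) 0.
by rewrite e sub0r oppr_eq0 => /hw.
Qed.

Lemma prechainB i l w : prechain Delta i l -> prechain Delta i w ->
  prechain Delta i (fun F T => l F T - w F T).
Proof.
move=> hl hw F T; have [e|/hl //] := eqVneq (l F T) 0.
by rewrite e sub0r oppr_eq0 => /hw.
Qed.

(* The product over u in A of the endomorphisms 1 - (d kap_u + kap_u d). *)
Definition retract A l F T : k :=
  if [disjoint F & T] && [disjoint T & A] then l (F :|: A) T else 0.

Lemma retract1 u l i F T : chain Delta i l ->
  l F T - cobd1 (kap u l) F T - kap u (cobd1 l) F T = retract [set u] l F T.
Proof.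
move=> hl; rewrite /retract [[disjoint _ & [set u]]]disjoint_sym disjoints1.
case: (boolP [disjoint F & T]) => dj /=; last first.
  have -> : l F T = 0 by apply/eqP; apply: contraNT dj => /hl[].
  rewrite /kap /cobd (negPf dj) subr0 sub0r; case: ifP => _; last by rewrite oppr0.
  rewrite (_ : [disjoint F & u |: T] = false) ?mulr0 ?oppr0 //.
  by apply: contraNF dj => h; apply: disjointWr h; rewrite subsetUr.
rewrite -addrA -opprD cobd_kap //.
case: ifPn => uT /=; first by rewrite subrr.
case: ifPn => uF; first by rewrite subr0 setUC (setUidPr _) // sub1set.
by rewrite opprB addrC subrK setUC.
Qed.

Lemma kap_prechain u i l : chain Delta i l -> prechain Delta i (kap u l).
Proof.
move=> hl F T; rewrite /kap; case: ifP => [/andP[uF uT]|]; last by rewrite eqxx.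
rewrite mulf_eq0 negb_or => /andP[_ /hl[FD dj]].
rewrite cardsU1 uT => <-; split=> //.
by apply: disjointWr dj; rewrite subsetUr.
Qed.

(** At [(F, T)] the homotopy reads l at [(F, u |: T)], so the complement of the union may grow by u.
    This is why only vertices of G are contracted. *)
Lemma kap_supported u G l : u \in G -> supported G l -> supported G (kap u l).
Proof.
move=> uG hl F T; rewrite /kap; case: ifP => [/andP[uF uT]|]; last by rewrite eqxx.
rewrite mulf_eq0 negb_or => /andP[_ /hl h].
apply/subsetP => j; have := subsetP h j; rewrite !inE.
by case: eqVneq => [-> //|_] /=.
Qed.

Lemma cobd_retract A l F T : cobd1 (retract A l) F T = retract A (cobd1 l) F T.
Proof.
rewrite /retract {1}/cobd; case: (boolP [disjoint F & T]) => //= dj.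
have dj1 t : [disjoint F & T :\ t] by apply: disjointWr dj; rewrite subsetDl.
have dj2 t : t \in T -> [disjoint t |: F & T :\ t].
  by move=> _; rewrite disjoints_subset subUset sub1set !inE eqxx -disjoints_subset dj1.
case: ifPn => TA.
  rewrite /cobd; have -> : [disjoint F :|: A & T].
    by rewrite disjoints_subset subUset -!disjoints_subset dj disjoint_sym TA.
  apply: eq_bigr => t tT; rewrite dj1 dj2 //.
  have -> : [disjoint T :\ t & A] by apply: disjointWl TA; rewrite subsetDl.
  by rewrite /= setUA.
apply: big1 => t tT; rewrite dj1 dj2 //= mul1r; case: ifPn => TtA; last first.
  by rewrite subrr mulr0.
suff tA : t \in A.
  rewrite (_ : t |: F :|: A = F :|: A) ?subrr ?mulr0 //.
  by rewrite -setUA setUCA (setUidPr (_ : [set t] \subset A)) // sub1set.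
apply: contraNT TA => tA; rewrite -(setD1K tT) disjoints_subset subUset sub1set.
by rewrite inE tA -disjoints_subset.
Qed.

(** On a cocycle, each single-vertex retraction subtracts the coboundary of [kap u]; these are
    composed over the vertices of G, and the primitives stay in the strand. *)
Lemma cocycle_retract i G l : chain Delta i l -> supported G l ->
  (forall F T, cobd1 l F T = 0) ->
  exists w, [/\ prechain Delta i w, supported G w &
    forall F T, l F T - cobd1 w F T = retract G l F T].
Proof.
move=> hl sl cl.
suff key : forall r : seq 'I_n, {subset r <= G} ->
  exists w, [/\ prechain Delta i w, supported G w &
    forall F T, l F T - cobd1 w F T = retract [set x in r] l F T].
  have [|w [h1 h2 h3]] := key (enum G); first by move=> v; rewrite mem_enum.
  exists w; split=> // F T; rewrite h3.
  by congr retract; apply/setP => j; rewrite inE mem_enum.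
elim=> [|v r IH] rG.
  exists (fun _ _ => 0); split=> [F T|F T|F T]; rewrite ?eqxx //.
  have -> : cobd1 (fun _ _ => 0) F T = 0.
    rewrite /cobd; case: ifP => // _; apply: big1 => t _.
    by rewrite mulr0 subr0 mulr0.
  rewrite subr0 /retract (_ : [set x in [::]] = set0); last first.
    by apply/setP => j; rewrite !inE.
  rewrite -[[disjoint T & _]]setI_eq0 setI0 eqxx andbT setU0; case: ifPn => // dj.
  by apply/eqP; apply: contraNT dj => /hl[].
have [|w [hw sw ew]] := IH; first by move=> x xr; apply: rG; rewrite inE xr orbT.
have vG : v \in G by apply: rG; rewrite inE eqxx.
pose l' F T := l F T - cobd1 w F T.
have hl' : chain Delta i l' by apply: chainB => //; apply: cobd_prechain.
have sl' : supported G l'.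
  by apply: supportedB => //; apply: cobd_supported.
have cl' F T : cobd1 l' F T = 0 by rewrite cobdB cl cobd_cobd subrr.
have kN : prechain Delta i (fun F T => - kap v l' F T).
  by move=> F T; rewrite oppr_eq0; apply: kap_prechain.
have sN : supported G (fun F T => - kap v l' F T).
  by move=> F T; rewrite oppr_eq0; apply: kap_supported.
exists (fun F T => w F T - - kap v l' F T); split.
- exact: prechainB.
- exact: supportedB.
move=> F T.
have -> : l F T - cobd1 (fun F T => w F T - - kap v l' F T) F T =
    retract [set v] l' F T.
  rewrite -(retract1 v F T hl') [kap v _ _ _](_ : _ = 0); last first.
    by rewrite /kap cl' mulr0 if_same.
  by rewrite subr0 cobdB cobdN opprK opprD addrA.
rewrite /retract; case: (boolP [disjoint F & T]) => //= dj.
rewrite disjoint_sym disjoints1.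
have -> : [set x in v :: r] = v |: [set x in r] by apply/setP => j; rewrite !inE.
case: (boolP (v \in T)) => vT /=.
  rewrite (_ : [disjoint T & _] = false) //; apply/negbTE.
  by rewrite -setI_eq0; apply/set0Pn; exists v; rewrite !inE eqxx vT.
rewrite /l' ew /retract.
have -> : [disjoint F :|: [set v] & T].
  by rewrite disjoints_subset subUset sub1set inE vT andbT -disjoints_subset.
have -> : [disjoint T & v |: [set x in r]] = [disjoint T & [set x in r]].
  by rewrite ![[disjoint T & _]]disjoint_sym !disjoints_subset subUset sub1set inE vT.
by rewrite /= setUA.
Qed.

(* The change of basis which compares the signs sgn t (~: (T :|: G)), coming
   from the resolution, with the signs sgn t T of the link of G. *)
Definition gauge G T : k :=
  \prod_(s in T) - ((-1) ^+ s * sg s G).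

(** T, G and the complement of their union partition the t vertices below t. *)
Lemma sgn_compl t T G : [disjoint T & G] ->
  sg t T * sg t G * sg t (~: (T :|: G)) = (-1) ^+ t.
Proof.
move=> dj; rewrite /sgn -!exprD; congr (_ ^+ _).
have e A : #|[set s in A | (s < t)%N]| =
      (\sum_(s : 'I_n | (s < t)%N) nat_of_bool (s \in A))%N.
  rewrite -sum1_card big_mkcond [RHS]big_mkcond; apply: eq_bigr => s _.
  by rewrite inE; case: (s \in A); case: (s < t)%N.
rewrite !e -!big_split /= (eq_bigr (fun _ => 1%N)).
  rewrite -(big_ord_widen n (fun _ => 1%N)) ?(ltnW (ltn_ord t)) //.
  by rewrite sum1_card card_ord.
move=> s _; rewrite !inE negb_or; case sT: (s \in T) => /=.
  by rewrite (disjointFr dj sT).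
by case: (s \in G).
Qed.

End LinkHomology.

(** * Strands of Ext as homology of links *)

Section ExtLink.
Variables (n : nat) (k : fieldType) (Delta : {set {set 'I_n}}).
Hypothesis Delta_closed : forall F G : {set 'I_n},
  F \in Delta -> G \subset F -> G \in Delta.
Local Notation sg := (sgn k).
Local Notation cobd1 := (@cobd n k (fun _ => 1)).
Implicit Types (s t u v : 'I_n) (F T G A : {set 'I_n}).
Implicit Types (l w : {set 'I_n} -> {set 'I_n} -> k) (a c : {set 'I_n} -> k).

Lemma gaugeK G T : gauge k G T * gauge k G T = 1.
Proof.
rewrite /gauge -big_split /= big1 // => s _.
by rewrite mulrNN mulrACA sgnK -expr2 sqrr_sign mulr1.
Qed.

Lemma gaugeU1 G t T : t \notin T -> t \notin G -> [disjoint T & G] ->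
  sg t T * gauge k G (t |: T) = - (gauge k G T * sg t (~: (T :|: G))).
Proof.
move=> tT tG dj; rewrite /gauge big_setU1 //= -(sgn_compl k t dj).
set g := \prod_(s in T) _; set z := sg t T; set h := sg t G; set w := sg t (~: _).
rewrite mulNr mulrN !mulrA sgnK mul1r [h * w]mulrC -(mulrA w) sgnK mulr1.
by rewrite mulrC.
Qed.

(* The only components of a cochain in the strand of G that are not killed by
   the retraction onto G are those at (F, ~: F) with G \subset F. *)
Definition restrict G l T : k :=
  if [disjoint T & G] then gauge k G T * l (T :|: G) (~: (T :|: G)) else 0.

(** At the pair of [T :|: G] and its complement, deleting t from the second set leaves t uncovered;
    t is not in G, so this value of l is 0. Only the terms that move t into the face remain, and
    they form the boundary in the link. *)
Lemma restrict_cobd G l : supported G l ->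
  forall T, sbd (restrict G l) T = restrict G (cobd1 l) T.
Proof.
move=> sl T; rewrite /sbd {2}/restrict; case: ifPn => dj; last first.
  apply: big1 => t tT; rewrite /restrict ifF ?mulr0 //.
  by apply: contraNF dj => h; apply: disjointWl h; rewrite subsetUr.
have djC : [disjoint T :|: G & ~: (T :|: G)] by rewrite -setI_eq0 setICr.
rewrite /cobd djC mulr_sumr (bigID (mem G)) /= big1 ?add0r; last first.
  move=> t /andP[tT tG]; rewrite /restrict ifF ?mulr0 //; apply/negbTE.
  by rewrite -setI_eq0; apply/set0Pn; exists t; rewrite !inE eqxx.
apply: eq_big => [t|t /andP[tT tG]]; first by rewrite !inE negb_or.
have djt : [disjoint t |: T & G].
  by rewrite disjoints_subset subUset sub1set inE tG -disjoints_subset.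
rewrite /restrict djt mulrA gaugeU1 // mulNr mul1r.
have -> : l (T :|: G) (~: (T :|: G) :\ t) = 0.
  apply/eqP; apply: contraT => /sl /subsetP/(_ t).
  by rewrite !inE eqxx (negPf tT) (negPf tG) /= => /(_ isT).
rewrite sub0r mulrA mulrN -setUA; congr (- (_ * l _ _)).
by rewrite setDE -setCU [_ :|: [set t]]setUC.
Qed.

(** A right inverse of [restrict] on cochains, in general not compatible with the coboundaries,
    since it vanishes where F does not contain G. *)
Definition extend G a F T : k :=
  if (G \subset F) && (T == ~: F) then gauge k G (F :\: G) * a (F :\: G) else 0.

Lemma extend_neq0 G a F T : extend G a F T != 0 ->
  [/\ G \subset F, T = ~: F & a (F :\: G) != 0].
Proof.
rewrite /extend; case: ifP => [/andP[GF /eqP ->]|]; last by rewrite eqxx.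
by rewrite mulf_eq0 negb_or => /andP[].
Qed.

Lemma extend_supported G a : supported G (extend G a).
Proof. by move=> F T /extend_neq0[_ -> _]; rewrite setUCr setCT sub0set. Qed.

Lemma extend_chain G a q i : (q + #|G| + i = n)%N ->
  link_chain Delta G q a -> chain Delta i (extend G a).
Proof.
move=> e ha F T /extend_neq0[GF -> /ha[dj FD cF]].
have eF : F :\: G :|: G = F by rewrite setUC setDE setUIr setUCr setIT (setUidPr GF).
split; first by rewrite -eF.
  by rewrite -setI_eq0 setICr.
have cF' : #|F| = (q + #|G|)%N.
  by rewrite -cF cardsD (setIidPr GF) subnK ?subset_leq_card.
by apply: (@addnI #|F|); rewrite cardsC card_ord cF' e.
Qed.

Lemma restrict_extend G a T : (forall T, a T != 0 -> [disjoint T & G]) ->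
  restrict G (extend G a) T = a T.
Proof.
move=> ha; rewrite /restrict; case: ifPn => dj; last first.
  by apply/esym/eqP; apply: contraNT dj => /ha.
rewrite /extend subsetUr eqxx /= mulrA setDUl setDv setU0.
have -> : T :\: G = T by apply/setDidPl.
by rewrite gaugeK mul1r.
Qed.

Lemma restrict_chain G l i q : (q + #|G| + i = n)%N ->
  chain Delta i l -> link_chain Delta G q (restrict G l).
Proof.
move=> e hl T; rewrite /restrict; case: ifP => [dj|_]; last by rewrite eqxx.
rewrite mulf_eq0 negb_or => /andP[_ /hl[TD _ cT]]; split=> //.
have := dj; rewrite -setI_eq0 => /eqP TG0.
apply: (@addIn #|G|); apply: (@addIn i).
by rewrite e -cardsUI TG0 cards0 addn0 -cT cardsC card_ord.
Qed.

(** [retract G] reads w at pairs [(F :|: G, T)]. The complement of the union avoids G, and the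
    support condition puts it inside G, so it is empty and the pair is one that [restrict] sees. *)
Lemma retract_eq0 G w : supported G w -> (forall T, restrict G w T = 0) ->
  forall F T, retract G w F T = 0.
Proof.
move=> sw rw F T; rewrite /retract; case: ifP => // /andP[dj dTG].
apply/eqP; apply: contraT => nz.
have eT : T = ~: (F :|: G).
  apply/eqP; rewrite eqEsubset -disjoints_subset disjoint_sym.
  rewrite disjoints_subset subUset -!disjoints_subset dj disjoint_sym dTG /=.
  have := sw _ _ nz; rewrite -setCS setCK => /subsetP h.
  apply/subsetP => j; rewrite !inE negb_or => /andP[jF jG].
  by have := h j; rewrite !inE (negPf jG) (negPf jF) /= => /(_ isT).
have := rw (F :\: G).
have dFG : [disjoint F :\: G & G].
  by rewrite -setI_eq0 setDE -setIA [~: G :&: G]setIC setICr setI0.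
have eFG : F :\: G :|: G = F :|: G by rewrite setUC setDE setUIr setUCr setIT setUC.
rewrite /restrict dFG eFG -eT => /(congr1 (fun x => gauge k G (F :\: G) * x)).
by rewrite mulrA gaugeK mul1r mulr0 => e; rewrite e eqxx in nz.
Qed.

(** A retracted cocycle lives on sets T of cardinality i disjoint from G, so it is 0 beyond this
    bound. The bound makes n - |G| - i a cardinality of faces in the link. *)
Lemma ext_nontrivial_card G i : ext_nontrivial k Delta i G -> (#|G| + i <= n)%N.
Proof.
case=> l [hl sl cl nb]; rewrite leqNgt; apply/negP => lt; apply: nb.
have [w [hw sw ew]] := cocycle_retract Delta_closed hl sl cl.
exists w; split=> // F T; apply/eqP; rewrite -subr_eq0 ew /retract.
case: ifP => // /andP[_ _]; apply: contraT => /hl[_ dj cT].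
have : (#|(F :|: G) :|: T| <= n)%N by have := max_card (F :|: G :|: T); rewrite card_ord.
rewrite leqNgt (leq_trans lt) // -cT.
move: dj; rewrite -setI_eq0 => /eqP dj0.
rewrite -[#|_ :|: T|]addn0 -(cards0 'I_n) -dj0 cardsUI leq_add2r.
by apply: subset_leq_card; rewrite subsetUr.
Qed.

(** Up to coboundaries, a cocycle is determined by its values at the pairs [(F, ~: F)] with G inside
    F, where the coboundary is the boundary of the link. The relation on q is |F| + |~: F| = n, with
    |F| = q + |G| and |~: F| = i. *)
Lemma ext_link G i q : (q + #|G| + i = n)%N ->
  ext_nontrivial k Delta i G <-> link_nontrivial k Delta G q.
Proof.
move=> e; split.
  case=> l [hl sl cl nb]; exists (restrict G l); split.
  - exact: restrict_chain hl.
  - by move=> T; rewrite restrict_cobd // /restrict cl mulr0 if_same.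
  case=> c hc ec; apply: nb.
  have hx : prechain Delta i (extend G c).
    move=> F T nz; have [GF eT cF] := extend_neq0 nz.
    have [dj FD cT] := hc _ cF.
    have cF' : #|F| = (q.+1 + #|G|)%N.
      by rewrite -cT cardsD (setIidPr GF) subnK ?subset_leq_card.
    split; last 1 first.
    - apply: (@addnI (q + #|G|)); rewrite e addnS -addSn -[n in RHS]card_ord.
      by rewrite -(cardsC F) cF' eT.
    - by move: FD; rewrite setUC setDE setUIr setUCr setIT (setUidPr GF).
    - by rewrite eT -setI_eq0 setICr.
  (* This correction makes the restriction zero, so [l'] retracts to 0 and is a coboundary. *)
  pose l' F T := l F T - cobd1 (extend G c) F T.
  have hl' : chain Delta i l' by apply: chainB => //; apply: cobd_prechain.
  have sl' : supported G l'.
    by apply: supportedB => //; apply: cobd_supported; apply: extend_supported.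
  have cl' F T : cobd1 l' F T = 0 by rewrite cobdB cl cobd_cobd subrr.
  have [w [hw sw ew]] := cocycle_retract Delta_closed hl' sl' cl'.
  have hcd T : c T != 0 -> [disjoint T & G] by case/hc.
  have r0 F T : retract G l' F T = 0.
    apply: retract_eq0 => // {F}{}T.
    have := restrict_cobd (@extend_supported G c) T.
    rewrite /sbd (eq_bigr (fun t => sg t T * c (t |: T))); last first.
      by move=> t _; rewrite restrict_extend.
    rewrite -/(sbd c T) -ec /restrict; case: ifP => // _ e1.
    by rewrite mulrBr e1 subrr.
  exists (fun F T => extend G c F T - - w F T); split.
  - by apply: prechainB => // F T; rewrite oppr_eq0; apply: hw.
  - apply: supportedB; first exact: extend_supported.
    by move=> F T; rewrite oppr_eq0; apply: sw.
  move=> F T; have := ew F T; rewrite r0 /l' => /eqP.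
  by rewrite subr_eq0 cobdB cobdN opprK => /eqP <-; rewrite addrC subrK.
(* [extend G a] need not be a cocycle, but its retract is one: the restriction of its coboundary is
   [sbd a], which is 0. *)
case=> a [ha ca nb]; pose l := retract G (extend G a).
have hadj T : a T != 0 -> [disjoint T & G] by case/ha.
have hx := extend_chain e ha.
have sx := @extend_supported G a.
exists l; split.
- move=> F T; rewrite /l /retract; case: ifP => [/andP[dj dTG] /hx[FD _ cT]|_].
    by split=> //; apply: Delta_closed FD _; rewrite subsetUl.
  by rewrite eqxx.
- move=> F T; rewrite /l /retract; case: ifP => [_ /extend_neq0[_ -> _]|_].
    by apply/subsetP => j; rewrite !inE; case: (j \in F); case: (j \in G).
  by rewrite eqxx.
- move=> F T; rewrite cobd_retract; apply: retract_eq0 => [|{F}{}T].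
    exact: cobd_supported.
  rewrite -restrict_cobd // -(ca T); apply: eq_bigr => t _.
  by rewrite restrict_extend.
- case=> w [hw sw ew]; apply: nb; exists (restrict G w).
    case: i e hw hx => [|i] e hw hx; last first.
      apply: (@restrict_chain G w i); last exact/prechainS.
      by rewrite !addSn -addnS.
    by move=> T; rewrite /restrict (prechain0 hw) mulr0 if_same eqxx.
  move=> T; rewrite restrict_cobd // -(restrict_extend T hadj) /restrict.
  case: ifP => // dj; rewrite -ew /l /retract.
  have -> : [disjoint T :|: G & ~: (T :|: G)] by rewrite -setI_eq0 setICr.
  have -> : [disjoint ~: (T :|: G) & G].
    by rewrite disjoint_sym disjoints_subset setCK subsetUr.
  by rewrite /= -setUA setUid.
Qed.

End ExtLink.

(** * Alexander duality *)

Section AlexanderDuality.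
Variables (n : nat) (k : fieldType) (Delta : {set {set 'I_n}}).
Hypothesis Delta_closed : forall F G : {set 'I_n},
  F \in Delta -> G \subset F -> G \in Delta.
Local Notation sg := (sgn k).
Implicit Types (s t u v : 'I_n) (F T G A : {set 'I_n}).
Implicit Types (a c : {set 'I_n} -> k).

Lemma sbdB a c T : sbd (fun T => a T - c T) T = sbd a T - sbd c T.
Proof. by rewrite /sbd -sumrB; apply: eq_bigr => t _; rewrite mulrBr. Qed.

Lemma sbd_eq a c T : a =1 c -> sbd a T = sbd c T.
Proof. by move=> e; apply: eq_bigr => t _; rewrite e. Qed.

Lemma sbd_neq0 a T : sbd a T != 0 -> exists2 t, t \notin T & a (t |: T) != 0.
Proof.
move=> nz; have /existsP[t /andP[h1 h2]] : [exists t, (t \notin T) && (a (t |: T) != 0)].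
  apply: contraNT nz; rewrite negb_exists => /forallP h.
  apply/eqP/big1 => t tT; move: (h t); rewrite tT negbK => /eqP ->.
  by rewrite mulr0.
by exists t.
Qed.

Lemma sbd_sbd a T : sbd (sbd a) T = 0.
Proof.
pose b s t := if (s \notin T) && (t \notin T)
  then sg s T * sg t (s |: T) * a (t |: (s |: T)) else 0.
rewrite -[RHS](@alternating_sum0 n _ b).
  rewrite /sbd big_mkcond; apply: eq_bigr => s _; rewrite /b.
  case: ifP => sT /=; last by rewrite big1.
  rewrite mulr_sumr [RHS]big_mkcond [LHS]big_mkcond; apply: eq_bigr => t _.
  rewrite in_setU1 negb_or; case: eqVneq => //= _.
  by case: ifP => //= tT; rewrite mulrA.
move=> s t st; rewrite /b [(t \notin T) && _]andbC; case: ifP => [/andP[sT tT]|].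
  by rewrite sgn_anti // mulNr setUCA.
by rewrite oppr0.
Qed.

Definition cone u a T : k := if u \in T then sg u T * a (T :\ u) else 0.

Lemma sbd_cone u a T : sbd (cone u a) T + cone u (sbd a) T = a T.
Proof.
rewrite /sbd; case: (boolP (u \in T)) => uT; last first.
  rewrite [X in _ + X]/cone (negPf uT) addr0 (bigD1 u) //= big1.
    by rewrite addr0 /cone setU11 setU1K // sgnUself mulrA sgnK mul1r.
  move=> t /andP[tT tu]; rewrite /cone in_setU1 (negPf uT) eq_sym (negPf tu) /=.
  by rewrite mulr0.
have uT' : u \notin T :\ u by rewrite !inE eqxx.
rewrite -(setD1K uT) -(setD1K uT); move: (T :\ u) uT' => {uT}T' uT'.
rewrite !(setU1K uT').
rewrite [X in _ + X]/cone setU11 setU1K // (bigD1 (P := fun t => t \notin T') u) //=.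
rewrite mulrDr mulrA sgnUself sgnK mul1r addrCA -[RHS]addr0; congr (_ + _).
rewrite [X in _ + sg u T' * X](eq_bigl (fun t => t \notin u |: T')); last first.
  by move=> t; rewrite in_setU1 negb_or andbC.
rewrite mulr_sumr -big_split big1 //= => t; rewrite in_setU1 negb_or => /andP[tu tT'].
rewrite /cone !inE eqxx orbT.
have -> : (t |: (u |: T')) :\ u = t |: T'.
  by rewrite setUCA setU1K // in_setU1 negb_or eq_sym tu.
rewrite setUCA sgnUself !mulrA -mulrDl.
by rewrite sgn_swap // [sg u T' * _]mulrC addNr mul0r.
Qed.

(* The chains of the full simplex on the complement of G modulo those of the
   link of G. *)
Definition rel_chain G q a := forall T, a T != 0 ->
  [/\ [disjoint T & G], T :|: G \notin Delta & #|T| = q].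

Definition rel_nontrivial G q := exists a,
  [/\ rel_chain G q a, forall T, T :|: G \notin Delta -> sbd a T = 0 &
      ~ exists2 c, rel_chain G q.+1 c &
          forall T, T :|: G \notin Delta -> a T = sbd c T].

Definition cut G (b : bool) a T : k := if (T :|: G \in Delta) == b then a T else 0.

Lemma cutD G a T : a T = cut G false a T + cut G true a T.
Proof. by rewrite /cut; case: (_ \in _); rewrite ?addr0 ?add0r. Qed.

Lemma sbd_face a G T : (forall T, a T != 0 -> T :|: G \in Delta) ->
  T :|: G \notin Delta -> sbd a T = 0.
Proof.
move=> ha TG; apply/eqP; apply: contraNT TG => /sbd_neq0[t tT /ha h].
by apply: Delta_closed h _; rewrite -setUA subsetUr.
Qed.

Lemma sbd_cut a G T : T :|: G \notin Delta -> sbd (cut G false a) T = sbd a T.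
Proof.
move=> TG; rewrite [RHS](sbd_eq _ (cutD G a)).
have -> : sbd (fun T => cut G false a T + cut G true a T) T =
    sbd (cut G false a) T + sbd (cut G true a) T.
  by rewrite /sbd -big_split; apply: eq_bigr => t _; rewrite mulrDr.
rewrite [X in _ + X](sbd_face _ TG) ?addr0 // => T'.
by rewrite /cut; case: ifP => [/eqP ->|] //; rewrite eqxx.
Qed.

Lemma cone_neq0 u a T : cone u a T != 0 -> u \in T /\ a (T :\ u) != 0.
Proof.
rewrite /cone; case: ifP => // uT; last by rewrite eqxx.
by rewrite mulf_eq0 negb_or => /andP[].
Qed.

Lemma cone_disjoint u a G T : u \notin G -> (forall T, a T != 0 -> [disjoint T & G]) ->
  cone u a T != 0 -> [disjoint T & G].
Proof.
move=> uG ha /cone_neq0[uT /ha dj]; rewrite -(setD1K uT).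
by rewrite disjoints_subset subUset sub1set inE uG -disjoints_subset.
Qed.

Lemma cone_card u a q T : (forall T, a T != 0 -> #|T| = q) ->
  cone u a T != 0 -> #|T| = q.+1.
Proof. by move=> ha /cone_neq0[uT /ha <-]; rewrite (cardsD1 u) uT. Qed.

Lemma sbd_disjoint a G T : (forall T, a T != 0 -> [disjoint T & G]) ->
  sbd a T != 0 -> [disjoint T & G].
Proof.
by move=> ha /sbd_neq0[t _ /ha]; apply: disjointWl; rewrite subsetUr.
Qed.

Lemma sbd_card a q T : (forall T, a T != 0 -> #|T| = q.+1) ->
  sbd a T != 0 -> #|T| = q.
Proof. by move=> ha /sbd_neq0[t tT /ha]; rewrite cardsU1 tT => -[]. Qed.

Lemma cutE G b a T : cut G b a T != 0 -> (T :|: G \in Delta) = b /\ a T != 0.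
Proof. by rewrite /cut; case: ifP => [/eqP //|]; rewrite eqxx. Qed.

Lemma cone_cycle u a T : (forall T, sbd a T = 0) -> sbd (cone u a) T = a T.
Proof.
move=> h; rewrite -[RHS](sbd_cone u) [X in _ + X](_ : _ = 0) ?addr0 //.
by rewrite /cone h mulr0 if_same.
Qed.

(** This is the connecting map of the pair of simplex and link: cycles of the link are coned from u,
    relative cycles go to their boundary. A vertex u outside G makes the simplex acyclic, and
    [cut G false] discards the components on the link. *)
Lemma link_rel G q u : u \notin G ->
  link_nontrivial k Delta G q <-> rel_nontrivial G q.+1.
Proof.
move=> uG; split=> -[a [ha ca nb]].
  have aG T : a T != 0 -> [disjoint T & G] by case/ha.
  have aq T : a T != 0 -> #|T| = q by case/ha.
  have cq := cone_card aq (u := u).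
  have cG := cone_disjoint uG aG.
  have acone := fun T => cone_cycle u T ca.
  exists (cut G false (cone u a)); split.
  - by move=> T /cutE[-> h]; split; [exact: cG h|by []|exact: cq h].
  - move=> T TG; rewrite sbd_cut // acone; apply/eqP.
    by apply: contraNT TG => /ha[].
  case=> c hc ec; apply: nb.
  have cc T : c T != 0 -> #|T| = q.+2 by case/hc.
  have cG' T : c T != 0 -> [disjoint T & G] by case/hc.
  exists (fun T => cone u a T - sbd c T) => [T|T]; last first.
    by rewrite sbdB acone sbd_sbd subr0.
  move=> nz; case: (boolP (T :|: G \in Delta)) => TG; last first.
    by move: nz; rewrite -ec // /cut (negPf TG) eqxx subrr eqxx.
  have [e|h] := eqVneq (cone u a T) 0; last by split; [exact: cG h|by []|exact: cq h].
  rewrite e sub0r oppr_eq0 in nz.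
  by split; [exact: sbd_disjoint cG' nz|by []|exact: sbd_card cc nz].
have aG T : a T != 0 -> [disjoint T & G] by case/ha.
have aq T : a T != 0 -> #|T| = q.+1 by case/ha.
exists (sbd a); split=> [T nz|T|[c hc ec]].
- split; [exact: sbd_disjoint aG nz| |exact: sbd_card aq nz].
  by apply: contraNT nz => /ca ->.
- exact: sbd_sbd.
apply: nb; pose d T := a T - c T.
have dc T : sbd d T = 0 by rewrite sbdB ec subrr.
have dG T : d T != 0 -> [disjoint T & G].
  have [e|/aG //] := eqVneq (a T) 0.
  by rewrite /d e sub0r oppr_eq0 => /hc[].
have dq T : d T != 0 -> #|T| = q.+1.
  have [e|/aq //] := eqVneq (a T) 0.
  by rewrite /d e sub0r oppr_eq0 => /hc[].
exists (cut G false (cone u d)).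
  move=> T /cutE[-> h]; split=> //; first exact: cone_disjoint dG h.
  exact: cone_card dq h.
move=> T TG; rewrite sbd_cut // cone_cycle // /d.
suff -> : c T = 0 by rewrite subr0.
by apply/eqP; apply: contraNT TG => /hc[].
Qed.

(** In cardinality 0 every chain is a cycle, and its cone from any vertex outside G bounds it. On
    the Betti side, k[Delta^vee] is generated in degree 0. *)
Lemma rel_nontrivial0 G : rel_nontrivial G 0 -> G = [set: 'I_n].
Proof.
case=> a [ha ca nb]; apply/eqP; rewrite eqEsubset subsetT /=.
apply/subsetP => u _; apply: contrapT => /negP uG; apply: nb.
have aq T : a T != 0 -> #|T| = 0%N by case/ha.
have aG T : a T != 0 -> [disjoint T & G] by case/ha.
have {}ca T : sbd a T = 0.
  apply: contrapT => /eqP/sbd_neq0[t tT /aq/eqP].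
  by rewrite cards_eq0 => /eqP/setP/(_ t); rewrite !inE eqxx.
exists (cut G false (cone u a)).
  move=> T /cutE[-> h]; split=> //; first exact: cone_disjoint aG h.
  exact: cone_card aq h.
by move=> T TG; rewrite sbd_cut // cone_cycle.
Qed.

Local Notation Dual := (alexander_dual Delta).

Lemma dual_face G T : (~: (G :|: T) \in Dual) = (T :|: G \notin Delta).
Proof. by rewrite inE setCK setUC. Qed.

(** In this strand T determines F as [~: (G :|: T)], a face of the dual exactly when [T :|: G] is no
    face of Delta. With x = 0 only the terms moving t into F are left, and they carry the minus
    sign. *)
Lemma bd_strand f G T : (forall F T, f F T != 0 -> F :|: T = ~: G) ->
  bd (fun _ => 0 : k) Dual f (~: (G :|: T)) T =
  if T :|: G \notin Delta then - sbd (fun T => f (~: (G :|: T)) T) T else 0.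
Proof.
move=> hf; rewrite /bd dual_face; case: ifP => // TG.
rewrite /sbd -sumrN; apply: eq_bigr => t tT; rewrite mul0r sub0r mulrN.
congr (- (_ * _)).
have -> : ~: (G :|: T) :\ t = ~: (G :|: (t |: T)).
  by rewrite setDE -setCU -setUA [T :|: _]setUC.
case tG: (t \in ~: (G :|: T)); first by [].
rewrite mulr0n; apply/esym/eqP; apply: contraFT tG => /hf /setP/(_ t).
by rewrite !inE eqxx orbT (negPf tT) orbF => <-.
Qed.

Lemma strand_rel i G :
  strand_nontrivial k Dual i (~: G) <-> rel_nontrivial G i.
Proof.
have eU G' T : [disjoint T & G'] -> ~: (G' :|: T) :|: T = ~: G'.
  move=> dj; apply/setP => j; rewrite !inE; case jT: (j \in T).
    by rewrite orbT (disjointFr dj jT).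
  by rewrite !orbF.
have eF F T : F :|: T = ~: G -> [disjoint F & T] -> F = ~: (G :|: T).
  move=> e dj; apply/setP => j; have /setP/(_ j) := e; rewrite !inE negb_or.
  case jT: (j \in T); first by rewrite andbF (disjointFl dj jT).
  by rewrite orbF andbT.
have dG F T : F :|: T = ~: G -> [disjoint T & G].
  by move=> e; rewrite disjoints_subset -e subsetUr.
have bdF j f F T : chain Dual j f -> (forall F T, f F T != 0 -> F :|: T = ~: G) ->
    F != ~: (G :|: T) -> bd (fun _ => 0 : k) Dual f F T = 0.
  move=> hf sf FT; apply/eqP; apply: contraNT FT => nz.
  have dj : [disjoint F & T].
    case: j hf => [|j] hf; last by have [] := bd_chain hf nz.
    by rewrite bd_chain0 ?eqxx in nz.
  apply/eqP/eF => //; apply/eqP; apply: contraNT nz => ne.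
  rewrite (bd_mod_local _ (g := fun _ _ => 0)) ?bd0 // => F' T' e.
  by apply/eqP; apply: contraNT ne => /sf <-; rewrite e.
split.
  case=> f [hf sf cf nb]; exists (fun T => f (~: (G :|: T)) T); split.
  - move=> T nz; have [FD dj cT] := hf _ _ nz; split=> //; last by rewrite -dual_face.
    exact: dG (sf _ _ nz).
  - move=> T TG; have := cf (~: (G :|: T)) T; rewrite bd_strand // TG.
    by move/eqP; rewrite oppr_eq0 => /eqP.
  case=> c hc ec; apply: nb.
  (* The sign offsets the one in [bd_strand]. *)
  pose g F T := if F == ~: (G :|: T) then - c T else 0.
  have hs F T : g F T != 0 -> F :|: T = ~: G.
    rewrite /g; case: ifP => [/eqP ->|]; last by rewrite eqxx.
    by rewrite oppr_eq0 => /hc[dj _ _]; apply: eU.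
  have hg : chain Dual i.+1 g.
    move=> F T; rewrite /g; case: ifP => [/eqP ->|]; last by rewrite eqxx.
    rewrite oppr_eq0 => /hc[dj TD cT]; split=> //; first by rewrite dual_face.
    by rewrite disjoint_sym disjoints_subset setCK subsetUr.
  exists g => // F T; have [->|FT] := eqVneq F (~: (G :|: T)); last first.
    rewrite (bdF _ _ _ _ hg hs FT); apply/eqP; apply: contraNT FT => nz.
    by have [_ dj _] := hf _ _ nz; apply/eqP/eF => //; apply: sf.
  rewrite bd_strand //; case: ifPn => TG; last first.
    by apply/eqP; apply: contraNT TG => /hf[]; rewrite dual_face.
  rewrite ec // -sumrN; apply: eq_bigr => t _.
  by rewrite /g eqxx mulrN opprK.
case=> a [ha ca nb]; pose f F T := if F == ~: (G :|: T) then a T else 0.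
have sf F T : f F T != 0 -> F :|: T = ~: G.
  rewrite /f; case: ifP => [/eqP ->|]; last by rewrite eqxx.
  by move=> /ha[dj _ _]; apply: eU.
have hf : chain Dual i f.
  move=> F T; rewrite /f; case: ifP => [/eqP ->|]; last by rewrite eqxx.
  move=> /ha[dj TD cT]; split=> //; first by rewrite dual_face.
  by rewrite disjoint_sym disjoints_subset setCK subsetUr.
have fa T : f (~: (G :|: T)) T = a T by rewrite /f eqxx.
exists f; split=> // [F T|].
  have [->|FT] := eqVneq F (~: (G :|: T)); last exact: bdF hf sf FT.
  rewrite bd_strand //; case: ifP => // TG.
  by rewrite (sbd_eq _ fa) ca ?oppr0.
case=> g hg eg; apply: nb.
pose gW F T := if F :|: T == ~: G then g F T else 0.
have sW F T : gW F T != 0 -> F :|: T = ~: G.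
  by rewrite /gW; case: ifP => [/eqP //|]; rewrite eqxx.
exists (fun T => - gW (~: (G :|: T)) T) => [T|T TG].
  rewrite oppr_eq0 => nz; have dj := dG _ _ (sW _ _ nz).
  move: nz; rewrite /gW; case: ifP => [_ /hg[]|]; last by rewrite eqxx.
  by rewrite dual_face.
have [dj|dj] := boolP [disjoint T & G]; last first.
  have -> : a T = 0 by apply/eqP; apply: contraNT dj => /ha[].
  apply/esym/eqP; apply: contraNT dj => /sbd_neq0[t tT].
  rewrite oppr_eq0 => /sW/dG; apply: disjointWl; exact: subsetUr.
rewrite -fa eg (bd_mod_local _ (g := gW)) => [|F' T' e]; last first.
  by rewrite /gW e eU // eqxx.
rewrite bd_strand // TG -sumrN; apply: eq_bigr => t _.
by rewrite mulrN.
Qed.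

End AlexanderDuality.

(** * Matching the indices of both sides *)

Section Assembly.
Variables (n : nat) (k : fieldType) (Delta : {set {set 'I_n}}).
Hypothesis Delta_closed : forall F G : {set 'I_n},
  F \in Delta -> G \subset F -> G \in Delta.
Hypothesis Delta0 : set0 \in Delta.
Hypothesis DeltaT : [set: 'I_n] \notin Delta.
Implicit Types (F G T : {set 'I_n}).

Lemma dual_closed F G :
  F \in alexander_dual Delta -> G \subset F -> G \in alexander_dual Delta.
Proof.
rewrite !inE => h GF; apply: contra h => /Delta_closed; apply.
by rewrite setCS.
Qed.

Lemma dual_set0 : set0 \in alexander_dual Delta.
Proof. by rewrite inE setC0. Qed.

Lemma link_nontrivial_witness G q : link_nontrivial k Delta G q ->
  exists T, [/\ [disjoint T & G], T :|: G \in Delta & #|T| = q].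
Proof.
case=> a [ha _ nb]; apply: contrapT => no; apply: nb.
exists (fun _ => 0) => [T|T]; first by rewrite eqxx.
transitivity (0 : k); last by rewrite /sbd big1 // => t _; rewrite mulr0.
by apply/eqP; apply: contraT => /ha h; case: no; exists T.
Qed.

Lemma link_nontrivial_face G q : link_nontrivial k Delta G q ->
  [/\ G \in Delta, (#|G| < n)%N & (q + #|G| <= n)%N].
Proof.
case/link_nontrivial_witness => T [dj TG cT].
have GD : G \in Delta by apply: Delta_closed TG _; rewrite subsetUr.
split=> //.
  have GT : G != setT by apply: contraNneq DeltaT => <-.
  by have := proper_card (_ : G \proper setT); rewrite cardsT card_ord properT => ->.
move: dj; rewrite -setI_eq0 => /eqP TG0.
rewrite -cT -cardsUI TG0 cards0 addn0.
by have := max_card (T :|: G); rewrite card_ord.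
Qed.

Lemma rel_nontrivial_witness G q : rel_nontrivial k Delta G q ->
  exists T, [disjoint T & G] /\ #|T| = q.
Proof.
case=> a [ha _ nb]; apply: contrapT => no; apply: nb.
exists (fun _ => 0) => [T|T _]; first by rewrite eqxx.
transitivity (0 : k); last by rewrite /sbd big1 // => t _; rewrite mulr0.
by apply/eqP; apply: contraT => /ha[dj _ cT]; case: no; exists T.
Qed.

(** The inequality amounts to q + 1 <= r, where q + 1 is the homological degree on the Betti side.
    Both sides of the theorem are reduced to this condition. *)
Definition depth_witness (r : nat) (j : int) := exists G q,
  [/\ (#|G| + q)%N%:Z = j, j - r%:Z + 1 <= #|G|%:Z & link_nontrivial k Delta G q].

Lemma dim_ext_witness (A : free_resolution (SR k Delta)) (r : nat) (j : int) :
  dim_ge (ext_ann A (n%:Z - j)) (j - r%:Z + 1) <-> depth_witness r j.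
Proof.
pose P := SR_resolution k Delta_closed Delta0.
split=> [|[G [q [ej hG hl]]]].
  move: (erefl (n%:Z - j)); case: {2 3}(n%:Z - j) => i ei; last first.
    (* For n - j < 0 every scalar annihilates Ext, so the first prime of the chain would contain
       1. *)
    by case=> e [Q [_ hQ _]]; have := hQ 1 I; rewrite idealr1.
  move=> hd; apply: contrapT => no; apply: dim_ge_bound hd => U hU.
  apply: (@ext_ann_transfer _ _ P).
  have := @ext_ann_monomial _ _ _ Delta_closed Delta0 i (j - r%:Z + 1) _ U hU.
  apply=> G hG hx; apply: no.
  have hc := ext_nontrivial_card Delta_closed hx.
  exists G, (n - (#|G| + i))%N; split=> //; first by lia.
  by apply/(ext_link _ Delta_closed (i := i)) => //; lia.
have [GD Gn qG] := link_nontrivial_face hl.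
have -> : n%:Z - j = (n - (q + #|G|))%N by lia.
apply: dim_ge_var hG _ => s /(ext_ann_transfer P) hs.
apply: (ext_ann_nontrivial (Delta_closed := Delta_closed) (Delta0 := Delta0)) hs.
by apply/(ext_link _ Delta_closed (q := q)) => //; lia.
Qed.

Lemma betti_witness
    (A : min_graded_free_resolution (@SR_piece n k (alexander_dual Delta)))
    (r : nat) (y : int) :
  (exists i : nat, (i <= r)%N /\ betti A i (i%:Z + y) <> 0%N) ->
  y = 0 \/ depth_witness r (n%:Z - y - 1).
Proof.
case=> i [ir /(betti_strandP dual_closed dual_set0)[W cW]].
rewrite -[W]setCK => /strand_rel hr.
have cG := cardsC W; rewrite card_ord in cG.
case: i => [|q] in ir cW hr *.
  have W0 : W = set0 by rewrite -[W]setCK (rel_nontrivial0 Delta_closed hr) setCT.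
  by left; move: cW; rewrite W0 cards0; lia.
(* With i = q + 1 and |W| = i + y, the face [~: W] has cardinality n - q - 1 - y, so j = n - y -
   1. *)
right; exists (~: W), q; split; [lia|lia|].
have [u uW|W0] := pickP (mem W).
  by apply/(link_rel _ Delta_closed _ (u := u)); rewrite ?inE ?negbK.
have [T [/disjoint_setI0 TW cT]] := rel_nontrivial_witness hr.
have W1 : W = set0 by apply/setP => j; rewrite inE; apply: W0.
by move: cT; rewrite -[T]setIT -setC0 -W1 TW cards0.
Qed.

Lemma depth_witness_betti
    (A : min_graded_free_resolution (@SR_piece n k (alexander_dual Delta)))
    (r : nat) (j : int) : depth_witness r j ->
  exists i : nat, (i <= r)%N /\ betti A i (i%:Z + (n%:Z - j - 1)) <> 0%N.
Proof.
case=> G [q [ej hG hl]]; have [GD Gn qG] := link_nontrivial_face hl.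
have [u uG|G0] := pickP (fun u => u \notin G); last first.
  move: Gn; rewrite (_ : G = setT) ?cardsT ?card_ord ?ltnn //.
  by apply/setP => u; have := G0 u; rewrite inE => /negbFE.
exists q.+1; split; first by lia.
apply/(betti_strandP dual_closed dual_set0); exists (~: G).
  by have := cardsC G; rewrite card_ord; lia.
by apply/strand_rel/(link_rel _ Delta_closed _ uG).
Qed.

(** The link of a face of maximal cardinality consists of the empty set alone and has homology in
    cardinality 0. *)
Lemma depth_witness_facet (r : nat) : (0 < r)%N ->
  exists2 G : {set 'I_n}, (#|G| < n)%N & depth_witness r #|G|.
Proof.
move=> r0; pose G := [arg max_(F > set0 | F \in Delta) #|F|].
have [GD Gmax] : G \in Delta /\ forall F, F \in Delta -> (#|F| <= #|G|)%N.
  by rewrite /G; case: arg_maxnP.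
have hl : link_nontrivial k Delta G 0.
  exists (fun T => (T == set0)%:R); split.
  - move=> T; case: (eqVneq T set0) => [-> _|_]; last by rewrite eqxx.
    by rewrite set0U cards0 -setI_eq0 set0I eqxx.
  - move=> T; rewrite /sbd big1 // => t _.
    by rewrite (_ : (t |: T == set0) = false) ?mulr0 // -cards_eq0 cardsU1;
      case: (t \in T) (cardsD1 t T) => //= ->.
  case=> c hc /(_ set0); rewrite eqxx /sbd => /esym/eqP.
  rewrite big1 ?(eq_sym 0) ?oner_eq0 //.
  move=> t _; rewrite (_ : c _ = 0) ?mulr0 //; apply/eqP; apply: contraT.
  case/hc => dj /Gmax; rewrite setU0 cardsU1 in dj *.
  by rewrite -disjoints1 dj ltnn.
have [_ Gn _] := link_nontrivial_face hl.
by exists G => //; exists G, 0%N; split=> //; lia.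
Qed.

End Assembly.

Theorem theorem1p2 (k : fieldType) (n : nat) (Delta : {set {set 'I_n}})
    (hDelta : simplicial_complex Delta) (hpure : pure Delta)
    (hne : Delta != powerset [set: 'I_n]) (r : nat) (hr : (2 <= r)%N)
    (F : min_graded_free_resolution
           (@SR_piece n k (alexander_dual Delta)))
    (G : free_resolution (SR k Delta)) :
  exists d : int,
    is_serre_depth G r d /\
    is_max (fun j : int =>
              exists i : nat, (i <= r)%N /\ betti F i (i%:Z + j) <> 0%N)
           (n%:Z - d - 1).
Proof.
have [/set0Pn[F0 F0D] closed] := hDelta.
have D0 : set0 \in Delta by apply: closed F0D (sub0set _).
have DT : [set: 'I_n] \notin Delta.
  apply: contra hne => DT; apply/eqP/setP => A.
  by rewrite powersetE subsetT; apply: closed DT (subsetT A).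
have [H Hn wH] := depth_witness_facet k closed D0 DT (ltnW hr).
(* Every witness j is some |G| + q, so the minimum over the integers can be taken over the
   naturals. *)
pose good := [pred j : nat | `[< depth_witness k Delta r j >]].
have exg : exists j, good j by exists #|H|; apply/asboolP.
case: (ex_minnP exg) => d /asboolP wd dmin.
have dmin' j : depth_witness k Delta r j -> d%:Z <= j.
  by move=> w; have [A [q [e _ _]]] := w; rewrite -e lez_nat dmin //= e; apply/asboolP.
exists d%:Z; split.
  split; first exact/(dim_ext_witness closed D0 DT).
  by move=> j /(dim_ext_witness closed D0 DT)/dmin'.
split; first exact: depth_witness_betti.
move=> y /(betti_witness closed D0 DT)[->|/dmin']; last by lia.
(* The remaining case y = 0, where d <= |H| < n gives 0 <= n - d - 1. *)
by have := dmin' _ wH; lia.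
Qed.
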